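(* Let $r\ge 1$ and $c\ge 1$ be integers. The free nilpotent group $N_{r,c}$ of class $c$ and finite rank $r$ is recurrent transitive self-similar. Furthermore, $N_{r,c}$ is an automata group.
   Context: **Free nilpotent groups.** $N_{r,c}=F_r/\gamma_{c+1}(F_r)$, where $F_r$ is the free group of rank $r$ and $\gamma_i$ denotes the $i$-th term of the lower central series ($\gamma_1(F_r)=F_r$). **Trees and states.** For an integer $m\ge 2$ and $Y=\{1,\dots,m\}$, let $\mathcal{T}_m$ be the regular one-rooted $m$-ary tree of finite words over $Y$ (root the empty word; $u$ is joined to $uy$ for every word $u$ and every $y\in Y$). Let $\mathcal{A}_m=\mathrm{Aut}(\mathcal{T}_m)$, acting on the right. Each $\alpha\in\mathcal{A}_m$ is written uniquely as $\alpha=(\alpha_1,\dots,\alpha_m)\sigma(\alpha)$ with $\alpha_i\in\mathcal{A}_m$ and $\sigma(\alpha)\in \mathrm{Perm}(Y)$, where $(yu)^\alpha=y^{\sigma(\alpha)}u^{\alpha_y}$ for $y\in Y$ and every word $u$. The set of states $Q(\alpha)$ is the smallest set containing $\alpha$ and closed under passing from $\beta$ to its components $\beta_1,\dots,\beta_m$, i.e. $Q(\alpha)=\{\alpha\}\cup Q(\alpha_1)\cup\dots\cup Q(\alpha_m)$. The automorphism $\alpha$ is finite-state if $Q(\alpha)$ is finite. **Self-similarity.** A subgroup $G\le\mathcal{A}_m$ is state-closed (self-similar) if $Q(\alpha)\subseteq G$ for all $\alpha\in G$, and transitive if it acts transitively on the first level $Y$ of the tree. An abstract group is (transitive) self-similar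 if, for some $m\ge 2$, it has a faithful representation into $\mathcal{A}_m$ whose image is state-closed (and transitive). **Virtual endomorphisms.** A virtual endomorphism of a group $G$ is a homomorphism $f:H\to G$ where $H\le G$ has finite index $m$. It is simple if the only subgroup $K\le H$ that is normal in $G$ and satisfies $K^f\le K$ is the trivial one. It is recurrent if it is surjective. A group $G$ is transitive self-similar if and only if there is a simple virtual endomorphism $f:H\to G$ with $[G:H]=m\ge2$ finite. A group $G$ is recurrent (transitive) self-similar if there is such an $f$ that is both simple and surjective. **Automata groups.** A group is an automata group if it is (isomorphic to) a group generated by the states of an invertible finite-state automaton; equivalently, it is isomorphic to a finitely generated state-closed subgroup of $\mathcal{A}_m$, for some $m\ge2$, all of whose elements are finite-state. *)

(* Defs.v *)
From HB Require Import structures.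
From mathcomp Require Import all_boot fingroup perm generic_quotient.
From mathcomp Require Import boolp classical_sets functions cardinality.

Set Implicit Arguments.
Unset Strict Implicit.
Unset Printing Implicit Defensive.

Local Open Scope quotient_scope.
Local Open Scope classical_set_scope.
Local Open Scope group_scope.

Section Subgroups.
Variable G : groupType.
Implicit Types (A H K : set G) (x y g : G).

Definition is_subgroup H :=
  H 1 /\ (forall x y, H x -> H y -> H (x / y)).

Definition is_normal K :=
  is_subgroup K /\ (forall x g, K x -> K (x ^ g)).

Definition gen A : set G := smallest is_subgroup A.

Definition commutators H K : set G :=
  [set z | exists x y, [/\ H x, K y & z = [~ x, y]]].

(* The lower central series is indexed from 1, as ['L_n(G)] is for finite
   groups; the index 0 also gives the whole group. *)
Definition lcs n : set G :=
  iter n.-1 (fun H => gen (commutators H setT)) setT.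

Definition right_coset H g : set G := [set h * g | h in H].

Definition has_index H m : Prop := (range (right_coset H) #= `I_m)%card.

Lemma subgroup1 H : is_subgroup H -> H 1.
Proof. by case. Qed.

Lemma subgroupV H x : is_subgroup H -> H x -> H x^-1.
Proof. by case=> H1 HF Hx; rewrite -[x^-1]mul1g; apply: HF. Qed.

Lemma subgroupM H x y : is_subgroup H -> H x -> H y -> H (x * y).
Proof.
move=> sH Hx Hy; rewrite -[y]invgK.
by have [_ HF] := sH; apply: HF => //; apply: subgroupV.
Qed.

Lemma is_subgroupT : is_subgroup [set: G].
Proof. by []. Qed.

Lemma gen_subgroup A : is_subgroup (gen A).
Proof.
split=> [B [[B1 _] _] //|x y Ax Ay B [[B1 BF] AB]].
by apply: (BF); [apply: Ax | apply: Ay].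
Qed.

Lemma sub_gen A : A `<=` gen A.
Proof. by move=> x Ax B [_]; apply. Qed.

Lemma gen_sub A H : is_subgroup H -> A `<=` H -> gen A `<=` H.
Proof. by move=> sH AH x; apply. Qed.

Lemma gen_normal A : (forall x g, A x -> A (x ^ g)) -> is_normal (gen A).
Proof.
move=> AJ; split=> [|x g Ax]; first exact: gen_subgroup.
suff: gen A `<=` [set z | gen A (z ^ g)] by apply.
apply: gen_sub => [|z Az]; last by apply: sub_gen; apply: AJ.
split=> [|y z]; rewrite /= ?conj1g; first exact: (gen_subgroup A).1.
by rewrite conjMg conjVg; apply: (gen_subgroup A).2.
Qed.

Lemma lcs_normal n : is_normal (lcs n).
Proof.
rewrite /lcs; elim: n.-1 => [|k IH] //=.
apply: gen_normal => _ g [x [y [Hx _ ->]]].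
by exists (x ^ g), (y ^ g); split=> //; [apply: IH.2 | rewrite conjRg].
Qed.

End Subgroups.

Section Quotient.
Variables (G : groupType) (K : set G) (nK : is_normal K).

Definition coset_rel : rel G := fun x y => `[< K (x / y) >].

Lemma coset_rel_equiv : equiv_class_of coset_rel.
Proof.
have [sK _] := nK; split=> [x|x y|y x z].
- by apply/asboolP; rewrite divgg; apply: subgroup1.
- by apply/asboolP/asboolP => /(subgroupV sK); rewrite invgF.
- move=> /asboolP Kxy /asboolP Kyz; apply/asboolP.
  by have := subgroupM sK Kxy Kyz; rewrite mulgA mulgVK.
Qed.

Canonical coset_equiv := EquivRelPack coset_rel_equiv.

Definition quot_group := {eq_quot coset_equiv}.

HB.instance Definition _ := Choice.on quot_group.
HB.instance Definition _ := EqQuotient.on quot_group.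

Definition quot_proj (x : G) : quot_group := \pi_quot_group x.

Lemma quot_projP x y : quot_proj x = quot_proj y <-> K (x / y).
Proof. by split=> [/eqmodP/asboolP | H] //; apply/eqmodP/asboolP. Qed.

Lemma quot_projK (a : quot_group) : quot_proj (repr a) = a.
Proof. exact: reprK. Qed.

Definition quot_mul (a b : quot_group) := quot_proj (repr a * repr b).
Definition quot_inv (a : quot_group) := quot_proj (repr a)^-1.

Lemma quot_mulE x y : quot_mul (quot_proj x) (quot_proj y) = quot_proj (x * y).
Proof.
have [sK KJ] := nK.
have Kx : K (repr (quot_proj x) / x) by apply/quot_projP; rewrite quot_projK.
have Ky : K (repr (quot_proj y) / y) by apply/quot_projP; rewrite quot_projK.
apply/quot_projP; move: (repr (quot_proj x)) (repr (quot_proj y)) Kx Ky => x' y' Kx Ky.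
have -> : x' * y' / (x * y) = ((y' / y) ^ x'^-1) * (x' / x).
  by rewrite conjgE invgM invgK !mulgA mulgVK.
by apply: subgroupM => //; apply: KJ.
Qed.

Lemma quot_invE x : quot_inv (quot_proj x) = quot_proj x^-1.
Proof.
have [sK KJ] := nK.
have Kx : K (repr (quot_proj x) / x) by apply/quot_projP; rewrite quot_projK.
apply/quot_projP; move: (repr _) Kx => x' Kx.
have -> : x'^-1 / x^-1 = ((x' / x)^-1) ^ x'.
  by rewrite conjgE invgF invgK !mulgA mulgVK.
by apply: KJ; apply: subgroupV.
Qed.

Fact quot_mulA : associative quot_mul.
Proof.
move=> a b c; rewrite -[a]quot_projK -[b]quot_projK -[c]quot_projK.
by rewrite !quot_mulE mulgA.
Qed.

Fact quot_mul1g : left_id (quot_proj 1) quot_mul.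
Proof. by move=> a; rewrite -[a]quot_projK quot_mulE mul1g. Qed.

Fact quot_mulg1 : right_id (quot_proj 1) quot_mul.
Proof. by move=> a; rewrite -[a]quot_projK quot_mulE mulg1. Qed.

Fact quot_mulVg : left_inverse (quot_proj 1) quot_inv quot_mul.
Proof. by move=> a; rewrite -[a]quot_projK quot_invE quot_mulE mulVg. Qed.

Fact quot_mulgV : right_inverse (quot_proj 1) quot_inv quot_mul.
Proof. by move=> a; rewrite -[a]quot_projK quot_invE quot_mulE mulgV. Qed.

HB.instance Definition _ :=
  isGroup.Build quot_group quot_mulA quot_mul1g quot_mulg1
    quot_mulVg quot_mulgV.

Fact quot_projM : {morph quot_proj : x y / x * y}.
Proof. by move=> x y; rewrite [RHS]quot_mulE. Qed.

HB.instance Definition _ :=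
  isMultiplicative.Build G quot_group quot_proj quot_projM.

End Quotient.

Section FreeGroup.
Variable r : nat.

(* [(i, false)] stands for the generator x_i and [(i, true)] for its inverse. *)
Definition letter : Type := 'I_r * bool.
HB.instance Definition _ := Finite.on letter.

Definition inv_letter (a : letter) : letter := (a.1, ~~ a.2).

Definition reduced (w : seq letter) := sorted (fun a b => b != inv_letter a) w.

Record free_group := FreeGroup {
  free_word :> seq letter;
  free_wordP : reduced free_word }.

HB.instance Definition _ := [isSub for free_word].
HB.instance Definition _ := [Choice of free_group by <:].

(* Left multiplication of a reduced word by a letter, with the cancellation
   it may create; the product of reduced words iterates it. *)
Definition cons_red (a : letter) (w : seq letter) :=
  if w is b :: w' then if b == inv_letter a then w' else a :: w else [:: a].

Definition act_word (u w : seq letter) := foldr cons_red w u.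

Lemma inv_letterK : involutive inv_letter.
Proof. by case=> i b; rewrite /inv_letter /= negbK. Qed.

Lemma cons_red_reduced a w : reduced w -> reduced (cons_red a w).
Proof.
case: w => [|b w] //= wP; case: ifP => [_|/negbT ab]; last by rewrite /= ab.
by move: wP; rewrite /reduced /=; case: w => //= c w /andP[].
Qed.

Lemma act_word_reduced u w : reduced w -> reduced (act_word u w).
Proof. by move=> wP; elim: u => //= a u; apply: cons_red_reduced. Qed.

Lemma cons_redK a w : reduced w -> cons_red (inv_letter a) (cons_red a w) = w.
Proof.
case: w => [|b w] /=; first by rewrite inv_letterK eqxx.
case: eqP => [-> wP|_ _] /=; last by rewrite inv_letterK eqxx.
case: w wP => [|c w] //= /andP[cb _].
by rewrite (negPf cb).
Qed.

Lemma act_cons_red a u w : reduced u -> reduced w ->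
  act_word (cons_red a u) w = cons_red a (act_word u w).
Proof.
case: u => [|b u] //= _ wP; case: ifP => [/eqP ->|_] //=.
by rewrite -{1}[a]inv_letterK cons_redK // act_word_reduced.
Qed.

Lemma act_act_word u v w : reduced v -> reduced w ->
  act_word (act_word u v) w = act_word u (act_word v w).
Proof.
move=> vP wP; elim: u => //= a u <-.
by rewrite act_cons_red // act_word_reduced.
Qed.

Lemma act_word_nil u : reduced u -> act_word u [::] = u.
Proof.
rewrite /reduced; elim: u => //= a [|b u] IH //= /andP[ab uP].
by rewrite [cons_red b _]IH //= (negPf ab).
Qed.

Definition free_one : free_group := @FreeGroup [::] isT.

Definition free_mul (u v : free_group) : free_group :=
  FreeGroup (act_word_reduced u (free_wordP v)).

Definition inv_word (w : seq letter) := rev (map inv_letter w).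

Lemma inv_word_reduced w : reduced w -> reduced (inv_word w).
Proof.
rewrite /reduced /inv_word rev_sorted sorted_map.
apply: sub_sorted => a b /=; rewrite inv_letterK.
by apply: contraNneq => ->.
Qed.

Definition free_inv (u : free_group) : free_group :=
  FreeGroup (inv_word_reduced (free_wordP u)).

Lemma act_inv_word u w : reduced w -> act_word (inv_word u) (act_word u w) = w.
Proof.
rewrite /inv_word => wP; elim: u => //= a u IH.
by rewrite rev_cons /act_word foldr_rcons cons_redK // act_word_reduced.
Qed.

Lemma inv_wordK : involutive inv_word.
Proof.
move=> w; rewrite /inv_word map_rev revK -map_comp -[RHS]map_id.
by apply: eq_map => a /=; rewrite inv_letterK.
Qed.

Fact free_mulA : associative free_mul.
Proof.
by move=> u v w; apply: val_inj; rewrite /= act_act_word //; apply: free_wordP.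
Qed.

Fact free_mul1g : left_id free_one free_mul.
Proof. by move=> u; apply: val_inj. Qed.

Fact free_mulg1 : right_id free_one free_mul.
Proof.
by move=> u; apply: val_inj; rewrite /= act_word_nil //; apply: free_wordP.
Qed.

Fact free_mulVg : left_inverse free_one free_inv free_mul.
Proof.
move=> u; apply: val_inj => /=.
by rewrite -{2}[free_word u]act_word_nil ?act_inv_word //; apply: free_wordP.
Qed.

Fact free_mulgV : right_inverse free_one free_inv free_mul.
Proof.
move=> u; have := free_mulVg (free_inv u); congr (free_mul _ _ = _).
by apply: val_inj; rewrite /= inv_wordK.
Qed.

HB.instance Definition _ :=
  isGroup.Build free_group free_mulA free_mul1g free_mulg1
    free_mulVg free_mulgV.

Definition free_gen (i : 'I_r) : free_group := @FreeGroup [:: (i, false)] isT.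

Section Lift.
Variables (G : groupType) (x : 'I_r -> G).

Definition letter_val (a : letter) : G := if a.2 then (x a.1)^-1 else x a.1.

Definition free_lift (u : free_group) : G := \prod_(a <- u) letter_val a.

Lemma letter_valV a : letter_val (inv_letter a) = (letter_val a)^-1.
Proof. by case: a => i []; rewrite /letter_val /= ?invgK. Qed.

Lemma free_lift_gen i : free_lift (free_gen i) = x i.
Proof. by rewrite /free_lift big_seq1. Qed.

Fact free_liftM : {morph free_lift : u v / u * v}.
Proof.
move=> u v; rewrite /free_lift /=; elim: (free_word u) => [|a w IH] /=.
  by rewrite big_nil mul1g.
rewrite big_cons -mulgA -IH; case: (act_word w v) => [|b t] /=.
  by rewrite big_seq1 big_nil mulg1.
case: ifP => [/eqP ->|_]; last by rewrite !big_cons.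
by rewrite big_cons letter_valV mulgA mulgV mul1g.
Qed.

HB.instance Definition _ :=
  isMultiplicative.Build free_group G free_lift free_liftM.

End Lift.

End FreeGroup.

Definition free_nilpotent (r c : nat) : groupType :=
  quot_group (lcs_normal (free_group r) c.+1).

Section Tree.
Variable m : nat.
Implicit Types (u v w : seq 'I_m) (y : 'I_m).

Definition tree_adj u v :=
  (exists y, v = rcons u y) \/ (exists y, u = rcons v y).

(* Fixing the root is explicit; for [m >= 2] it follows from the other two
   conditions, the root being the only vertex of degree [m]. *)
Definition is_tree_aut (f : seq 'I_m -> seq 'I_m) :=
  [/\ bijective f, f [::] = [::]
    & forall u v, tree_adj (f u) (f v) <-> tree_adj u v].

Record tree_aut := TreeAut {
  tree_fun :> seq 'I_m -> seq 'I_m;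
  tree_autb : `[< is_tree_aut tree_fun >] }.

HB.instance Definition _ := [isSub for tree_fun].
HB.instance Definition _ := [Choice of tree_aut by <:].

Lemma tree_autP (f : tree_aut) : is_tree_aut f.
Proof. by apply/asboolP; apply: tree_autb. Qed.

Definition mk_tree_aut f (fP : is_tree_aut f) : tree_aut :=
  TreeAut (introT (asboolP _) fP).

Lemma tree_aut_eq (f g : tree_aut) : f =1 g -> f = g.
Proof. by move=> fg; apply: val_inj; apply: funext. Qed.

Lemma tree_aut_rcons f u y : is_tree_aut f ->
  exists z, f (rcons u y) = rcons (f u) z.
Proof.
case=> /bij_inj f_inj f0 fadj.
elim/last_ind: u y => [|u x IH] y.
  have /fadj[//|[z /esym]] : tree_adj [::] [:: y] by left; exists y.
  by rewrite f0; case: (f _).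
have /fadj[//|[z]] : tree_adj (rcons u x) (rcons (rcons u x) y).
  by left; exists y.
have [t ->] := IH x => /rcons_inj[/f_inj/(congr1 size)].
by rewrite !size_rcons => /eqP; rewrite -addn2 -{1}[size u]addn0 eqn_add2l.
Qed.

Lemma is_tree_autI f : bijective f -> f [::] = [::] ->
  (forall u y, exists z, f (rcons u y) = rcons (f u) z) -> is_tree_aut f.
Proof.
move=> f_bij f0 frc; split=> // u v.
have child a b z : f b = rcons (f a) z -> exists y, b = rcons a y.
  elim/last_ind: b => [|b y _]; first by rewrite f0; case: (f a).
  have [t ->] := frc b y => /rcons_inj[/(bij_inj f_bij) -> _].
  by exists y.
split=> [[[z /child]|[z /child]]|[[y ->]|[y ->]]]; [by left|by right| |].
  by have [z ->] := frc u y; left; exists z.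
by have [z ->] := frc v y; right; exists z.
Qed.

Lemma tree_aut_cat f u v : is_tree_aut f ->
  exists2 w, f (u ++ v) = f u ++ w & size w = size v.
Proof.
move=> fP; elim/last_ind: v => [|v y [w fw sw]].
  by exists [::]; rewrite ?cats0.
have [z] := tree_aut_rcons (u ++ v) y fP; rewrite rcons_cat fw => ->.
by exists (rcons w z); rewrite ?rcons_cat // !size_rcons sw.
Qed.

Lemma is_tree_aut_id : is_tree_aut id.
Proof. by split=> //; exists id. Qed.

Lemma is_tree_aut_comp f g :
  is_tree_aut f -> is_tree_aut g -> is_tree_aut (g \o f).
Proof.
move=> [fb f0 fadj] [gb g0 gadj]; split=> [||u v]; first exact: bij_comp.
  by rewrite /= f0.
by rewrite /= gadj.
Qed.

Lemma is_tree_aut_inv f g :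
  cancel f g -> cancel g f -> is_tree_aut f -> is_tree_aut g.
Proof.
move=> fK gK [_ f0 fadj]; split=> [||u v]; first by exists f.
  by rewrite -f0 fK.
by rewrite -fadj !gK.
Qed.

Lemma tree_aut_inv_ex (f : tree_aut) :
  {g | [/\ cancel f g, cancel g f & is_tree_aut g]}.
Proof.
apply: cid; have fP := tree_autP f; have [[g fK gK] _ _] := fP.
by exists g; split=> //; apply: is_tree_aut_inv fK gK fP.
Qed.

Definition tree_one : tree_aut := mk_tree_aut is_tree_aut_id.

(* Automorphisms act on the right: [f * g] is [f] followed by [g]. *)
Definition tree_mul (f g : tree_aut) : tree_aut :=
  mk_tree_aut (is_tree_aut_comp (tree_autP f) (tree_autP g)).

Definition tree_inv (f : tree_aut) : tree_aut :=
  let: exist _ (And3 _ _ gP) := tree_aut_inv_ex f in mk_tree_aut gP.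

Lemma tree_invK (f : tree_aut) : cancel f (tree_inv f).
Proof. by rewrite /tree_inv; case: tree_aut_inv_ex => g []. Qed.

Lemma tree_invKV (f : tree_aut) : cancel (tree_inv f) f.
Proof. by rewrite /tree_inv; case: tree_aut_inv_ex => g []. Qed.

Fact tree_mulA : associative tree_mul.
Proof. by move=> f g h; apply: tree_aut_eq. Qed.
Fact tree_mul1g : left_id tree_one tree_mul.
Proof. by move=> f; apply: tree_aut_eq. Qed.
Fact tree_mulg1 : right_id tree_one tree_mul.
Proof. by move=> f; apply: tree_aut_eq. Qed.
Fact tree_mulVg : left_inverse tree_one tree_inv tree_mul.
Proof. by move=> f; apply: tree_aut_eq => u; apply: tree_invKV. Qed.
Fact tree_mulgV : right_inverse tree_one tree_inv tree_mul.
Proof. by move=> f; apply: tree_aut_eq => u; apply: tree_invK. Qed.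

HB.instance Definition _ :=
  isGroup.Build tree_aut tree_mulA tree_mul1g tree_mulg1
    tree_mulVg tree_mulgV.

Lemma tree_mulE (f g : tree_aut) u : (f * g) u = g (f u).
Proof. by []. Qed.

Definition level1_fun (f : tree_aut) y : 'I_m := head y (f [:: y]).

Lemma level1_funE (f : tree_aut) y : f [:: y] = [:: level1_fun f y].
Proof.
have [z] := tree_aut_rcons [::] y (tree_autP f).
by case: (tree_autP f) => _ -> _; rewrite /level1_fun /= => ->.
Qed.

Lemma level1_inj (f : tree_aut) : injective (level1_fun f).
Proof.
move=> x y exy; have [/bij_inj f_inj _ _] := tree_autP f.
by have /f_inj[] : f [:: x] = f [:: y] by rewrite !level1_funE exy.
Qed.

Definition level1 (f : tree_aut) : 'S_m := perm (@level1_inj f).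

Definition component_fun (f : tree_aut) y u := behead (f (y :: u)).

Lemma component_funE (f : tree_aut) y u :
  f (y :: u) = level1 f y :: component_fun f y u.
Proof.
have [w] := tree_aut_cat [:: y] u (tree_autP f).
by rewrite permE level1_funE /component_fun /= => ->.
Qed.

Lemma is_tree_aut_component (f : tree_aut) y : is_tree_aut (component_fun f y).
Proof.
have fP := tree_autP f; have [f_bij f0 _] := fP; have f_inj := bij_inj f_bij.
apply: is_tree_autI; last 1 first.
- move=> u z; have [t] := tree_aut_rcons (y :: u) z fP.
  by rewrite rcons_cons !component_funE rcons_cons => -[->]; exists t.
- exists (fun v => behead (tree_inv f (level1 f y :: v))) => u.
    by rewrite -component_funE tree_invK.
  have gf := tree_invKV f (level1 f y :: u).
  case: (tree_inv f (level1 f y :: u)) gf => [|x t]; first by rewrite f0.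
  by rewrite component_funE => -[/perm_inj ->].
- by rewrite /component_fun level1_funE.
Qed.

Definition component (f : tree_aut) y : tree_aut :=
  mk_tree_aut (is_tree_aut_component f y).

Lemma component_cons (f : tree_aut) y u :
  f (y :: u) = level1 f y :: component f y u.
Proof. exact: component_funE. Qed.

Definition states (f : tree_aut) : set tree_aut :=
  smallest (fun S : set tree_aut => forall g y, S g -> S (component g y))
    [set f].

Definition state_closed (S : set tree_aut) :=
  forall f, S f -> states f `<=` S.

Definition level1_transitive (S : set tree_aut) :=
  forall x y, exists2 f, S f & level1 f x = y.

End Tree.

Definition transitive_self_similar (G : groupType) :=
  exists m (phi : {multiplicative G -> tree_aut m}),
    [/\ (1 < m)%N, injective phi, state_closed (range phi)
      & level1_transitive (range phi)].

Section VirtualEndomorphism.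
Variables (G : groupType) (m : nat) (H : set G).

(* A homomorphism from [H] to [G] is given by a total map of which only the
   restriction to [H] is considered. *)
Definition virtual_endo (f : G -> G) :=
  [/\ is_subgroup H, has_index H m
    & forall x y, H x -> H y -> f (x * y) = f x * f y].

Definition simple_endo (f : G -> G) :=
  forall K : set G, is_normal K -> K `<=` H -> f @` K `<=` K -> K = [set 1].

Definition recurrent_endo (f : G -> G) := f @` H = setT.

End VirtualEndomorphism.

Definition recurrent_transitive_self_similar (G : groupType) :=
  transitive_self_similar G /\
  exists m (H : set G) (f : G -> G),
    [/\ (1 < m)%N, virtual_endo m H f, simple_endo H f & recurrent_endo H f].

(* Every output map is a permutation: the automaton is invertible. *)
Record automaton (m : nat) := Automaton {
  aut_state : finType;
  aut_out : aut_state -> 'S_m;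
  aut_next : aut_state -> 'I_m -> aut_state }.

Section Automaton.
Variables (m : nat) (A : automaton m).
Implicit Types (q : aut_state A) (u : seq 'I_m).

Fixpoint aut_act q u : seq 'I_m :=
  if u is y :: u' then aut_out q y :: aut_act (aut_next q y) u' else [::].

Fixpoint aut_act_inv q u : seq 'I_m :=
  if u is z :: u' then
    let y := (aut_out q)^-1 z in y :: aut_act_inv (aut_next q y) u'
  else [::].

Lemma is_tree_aut_act q : is_tree_aut (aut_act q).
Proof.
apply: is_tree_autI => // [|u]; last first.
  elim: u q => [|x u IH] q y /=; first by exists (aut_out q y).
  by have [z ->] := IH (aut_next q x) y; exists z.
exists (aut_act_inv q) => u; elim: u q => //= x u IH q.
  by rewrite permK IH.
by rewrite permKV IH.
Qed.

Definition state_aut q : tree_aut m := mk_tree_aut (is_tree_aut_act q).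

End Automaton.

Definition automata_group (G : groupType) :=
  exists m (A : automaton m) (phi : {multiplicative G -> tree_aut m}),
    [/\ (1 < m)%N, injective phi & range phi = gen (range (@state_aut m A))].

(* Main.v *)
From HB Require Import structures.
From mathcomp Require Import all_boot.
From mathcomp Require Import fingroup perm ssralg ssrnum ssrint zmodp.
From mathcomp Require Import generic_quotient.
From mathcomp Require Import boolp classical_sets functions cardinality.
Require Import Defs.
Import GRing.Theory Num.Theory.

(** Let F be the free group on x_1, ..., x_r, let gamma_i be its lower central
    series, N = F/gamma_(c+1), and let phi be the endomorphism of N that sends
    each x_i to its square. The virtual endomorphism is the inverse of phi,
    defined on H = phi(N); it is onto by construction.

    Modulo gamma_(i+1), phi raises the elements of gamma_i to the power 2^i:
    this holds for i = 1 on generators, and the commutator map is bilinear on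
    consecutive quotients ([sq_lcs]). Everything else follows from this and
    from one fact about F/gamma_(i+1): it has neither torsion nor infinitely
    divisible elements, stated together as [roots_bounded].
    - phi is injective, because the quotients gamma_i/gamma_(i+1) have no
      torsion ([sq_lcs_inj]).
    - H has finite index, because these quotients are finitely generated and
      phi acts on each of them as a power map ([sq_cosets]).
    - A subgroup of H stable under the inverse of phi consists of elements that
      are phi^n of something for every n; going down the series, they would be
      infinitely divisible in some gamma_i/gamma_(i+1), so the subgroup is
      trivial ([sq_divisible_trivial]) and the virtual endomorphism is simple.
    - Passing to a state divides the exponents in gamma_i/gamma_(i+1) by 2^i, up
      to a bounded error, so each element has finitely many states
      ([sq_states]).
    The coset tree of H then carries a faithful state-closed action, and the
    finitely many states of the generators form an automaton that generates N
    ([endo_self_similar]).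

    That F/gamma_(c+1) has no torsion is a theorem of Magnus and Witt. Here it
    is obtained by Lazard elimination on groups, with generators of arbitrary
    positive weights. Singling out a generator x of weight d, the free nilpotent
    group of weighted class c is the semidirect product of the cyclic group
    generated by x and of a group of the same kind, on the commutators
    [x_i, x, ..., x] with k entries x, of weight w_i + k d
    ([elim_roots_bounded]). Each step removes a generator of weight d and adds
    only generators of larger weight; when all weights exceed c the group is
    trivial, and bounded roots pass from a group to its semidirect products with
    the integers ([zsemi_roots_bounded]). *)

Set Implicit Arguments.
Unset Strict Implicit.
Unset Printing Implicit Defensive.

Local Open Scope classical_set_scope.
Local Open Scope group_scope.

(** * Homomorphisms and generators *)

Section Homs.
Variables (G A : groupType) (f : {multiplicative G -> A}).

Lemma hom1 : f 1 = 1.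
Proof. by apply: (mulgI (f 1)); rewrite -gmulfM !mulg1. Qed.

Lemma homM x y : f (x * y) = f x * f y.
Proof. exact: gmulfM. Qed.

Lemma homV x : f x^-1 = (f x)^-1.
Proof. by apply: (mulgI (f x)); rewrite -gmulfM !mulgV hom1. Qed.

Lemma homF x y : f (x / y) = f x / f y.
Proof. by rewrite gmulfM homV. Qed.

Lemma homJ x y : f (x ^ y) = f x ^ f y.
Proof. by rewrite !conjgE !gmulfM homV. Qed.

Lemma homR x y : f [~ x, y] = [~ f x, f y].
Proof. by rewrite !commgEl gmulfM homV homJ. Qed.

Lemma homX x n : f (x ^+ n) = f x ^+ n.
Proof. by elim: n => [|n IH]; rewrite ?hom1 // !expgS gmulfM IH. Qed.

Lemma preim_subgroup H : is_subgroup H -> is_subgroup (f @^-1` H).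
Proof.
move=> [H1 HF]; split=> [|x y fx fy]; first by rewrite /preimage /= hom1.
by rewrite /preimage /= homF; apply: HF.
Qed.

Lemma range_subgroup : is_subgroup (range f).
Proof.
split=> [|_ _ [x _ <-] [y _ <-]]; first by exists 1; rewrite ?hom1.
by exists (x / y); rewrite ?homF.
Qed.

End Homs.

Lemma eq_hom_subgroup (G A : groupType) (f g : {multiplicative G -> A}) :
  is_subgroup [set x | f x = g x].
Proof.
split=> [|x y /= fx gx]; first by rewrite /= !hom1.
by rewrite !homF fx gx.
Qed.

Lemma quot_proj_eq1 (G : groupType) (K : set G) (nK : is_normal K) x :
  quot_proj nK x = 1 <-> K x.
Proof.
have -> : 1 = quot_proj nK 1 by rewrite hom1.
by rewrite quot_projP divg1.
Qed.

Lemma quot_lift_ex (G A : groupType) (K : set G) (nK : is_normal K)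
    (f : {multiplicative G -> A}) : (forall x, K x -> f x = 1) ->
  exists g : {multiplicative quot_group nK -> A},
    forall x, g (quot_proj nK x) = f x.
Proof.
move=> fK; pose g0 (a : quot_group nK) : A := f (repr a).
have g0E x : g0 (quot_proj nK x) = f x.
  have /quot_projP/fK : quot_proj nK (repr (quot_proj nK x)) = quot_proj nK x.
    exact: quot_projK.
  by rewrite homF => /divg1_eq.
have g0M : {morph g0 : a b / a * b}.
  move=> a b; rewrite -[a](quot_projK (nK := nK)) -[b](quot_projK (nK := nK)).
  rewrite -gmulfM !g0E.
  exact: gmulfM.
by exists (HB.pack_for {multiplicative quot_group nK -> A} g0
            (isMultiplicative.Build _ _ g0 g0M)).
Qed.

Lemma free_group_gen r (H : set (free_group r)) :
  is_subgroup H -> (forall i, H (free_gen i)) -> forall u, H u.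
Proof.
move=> sH Hx [w]; elim: w => [|[i b] w IH] wP.
  by rewrite (_ : FreeGroup wP = 1); [apply: subgroup1|apply: val_inj].
have wP' : reduced w by move: wP => /= /path_sorted.
pose l : free_group r := @FreeGroup r [:: (i, b)] isT.
have -> : FreeGroup wP = l * FreeGroup wP'.
  apply: val_inj => /=; case: w wP {IH wP'} => [|c w] //= /andP[cP _].
  by rewrite (negPf cP).
apply: subgroupM (IH _) => //; rewrite {}/l.
case: b {wP} => //; last exact: Hx.
have -> : FreeGroup (free_word := [:: (i, true)]) isT = (free_gen i)^-1.
  exact: val_inj.
exact: subgroupV.
Qed.

(** * Central filtrations *)

Definition central_filtration (G : groupType) (A : nat -> set G) :=
  [/\ forall k, is_subgroup (A k), forall x, A 1%N x,
      forall k, A k.+1 `<=` A k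
    & forall i j x y, A i x -> A j y -> A (i + j)%N [~ x, y]].

Section Filtration.
Variables (G : groupType) (A : nat -> set G).
Hypothesis fA : central_filtration A.

Lemma filt_subgroup k : is_subgroup (A k). Proof. by case: fA. Qed.

Lemma filt_le i j : (i <= j)%N -> A j `<=` A i.
Proof.
case: fA => _ _ Ad _ /subnK <-; elim: (j - i)%N => // k IH x /Ad; exact: IH.
Qed.

Lemma filtT k x : (k <= 1)%N -> A k x.
Proof. by move=> k1; apply: (filt_le k1); case: fA. Qed.

Lemma filtR i j k x y : (k <= i + j)%N -> A i x -> A j y -> A k [~ x, y].
Proof.
by move=> kij Ax Ay; apply: (filt_le kij); case: fA => _ _ _; apply.
Qed.

Lemma filtM k x y : A k x -> A k y -> A k (x * y).
Proof. exact: subgroupM (filt_subgroup k). Qed.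

Lemma filtV k x : A k x -> A k x^-1.
Proof. exact: subgroupV (filt_subgroup k). Qed.

Lemma filtJ k x g : A k x -> A k (x ^ g).
Proof.
move=> Ax; rewrite -[x ^ g](mulVKg x) -commgEl; apply: filtM => //.
by apply: (@filtR k 1) => //; [apply: leq_addr|apply: filtT].
Qed.

Lemma filt_normal k : is_normal (A k).
Proof. by split=> [|x g]; [apply: filt_subgroup | apply: filtJ]. Qed.

End Filtration.

Lemma lcsS (G : groupType) n x y : lcs n.+1 x -> lcs (G := G) n.+2 [~ x, y].
Proof. by move=> Lx; apply: sub_gen; exists x, y. Qed.

Lemma lcs_ind (G : groupType) n (S : set G) : is_subgroup S ->
  (forall y g, lcs n.+1 y -> S [~ y, g]) -> forall x, lcs n.+2 x -> S x.
Proof. by move=> sS Sc; apply: gen_sub => // _ [y [g [Ly _ ->]]]; apply: Sc. Qed.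

Lemma lcs_decr (G : groupType) n : lcs n.+1 `<=` lcs (G := G) n.
Proof.
case: n => [|n] //; apply: lcs_ind; first by case: (lcs_normal G n.+1).
move=> x y Lx; have [sL nL] := lcs_normal G n.+1.
by rewrite commgEl; apply: subgroupM => //; [apply: subgroupV|apply: nL].
Qed.

(** The three subgroups lemma, by induction on the second argument: modulo the
    target term, conjugations of x by a and by g commute, because [x, a] is
    central and [x, g] commutes with a, so x commutes with [a, g]. *)
Lemma lcs_comm (G : groupType) i j (x y : G) :
  lcs i.+1 x -> lcs j.+1 y -> lcs (i + j).+2 [~ x, y].
Proof.
elim: j i x y => [|j IH] i x y Lx; first by rewrite addn0 => _; apply: lcsS.
rewrite addnS => Ly.
pose pi : {multiplicative G -> quot_group (lcs_normal G (i + j).+3)} :=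
  quot_proj (lcs_normal G (i + j).+3).
suff: forall z, lcs j.+2 z ->
    [set z | forall x, lcs i.+1 x -> commute (pi x) (pi z)] z.
  move=> /(_ y Ly x Lx) cxy; apply/(quot_proj_eq1 (lcs_normal G (i + j).+3)).
  by rewrite homR; apply/eqP/commgP.
apply: lcs_ind => [|a g La {}x {}Lx].
  split=> [z _ /=|a b /= Ca Cb z Lz]; first by rewrite hom1; apply: commute1.
  by rewrite homF; apply: commuteM; [apply: Ca|apply/commuteV/Cb].
have nL := (lcs_normal G i.+1).2.
wlog suff: x Lx / commute (pi (x ^ (g * a))) (pi [~ a, g]).
  move=> /(_ (x ^ (g * a)^-1)); rewrite conjgKV; apply; exact: nL.
have cu b : commute (pi [~ x, a]) (pi b).
  apply/commgP/eqP; rewrite -homR; apply/quot_proj_eq1.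
  by apply: lcsS; apply: IH.
have cv : commute (pi [~ x, g]) (pi a).
  apply/commgP/eqP; rewrite -homR; apply/quot_proj_eq1.
  by rewrite -addSn; apply: IH => //; apply: lcsS.
apply/commgP/conjg_fixP; rewrite -homJ -conjgM -commgC !conjgM.
have fixE z t : commute (pi z) (pi t) -> pi (z ^ t) = pi z.
  by move=> /commgP/conjg_fixP; rewrite -homJ.
have conjE (z t : G) : z ^ t = z * [~ z, t] by rewrite commgEl mulVKg.
have -> : pi ((x ^ a) ^ g) = pi x * (pi [~ x, g] * pi [~ x, a]).
  by rewrite (conjE x a) conjMg gmulfM (fixE _ _ (cu g)) (conjE x g) gmulfM mulgA.
have -> : pi ((x ^ g) ^ a) = pi x * (pi [~ x, a] * pi [~ x, g]).
  by rewrite (conjE x g) conjMg gmulfM (fixE _ _ cv) (conjE x a) gmulfM mulgA.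
by rewrite cu.
Qed.

Lemma lcs_filtration (G : groupType) : central_filtration (@lcs G).
Proof.
split=> // [k|k|i j x y Lx Ly]; first by case: (lcs_normal G k).
  exact: lcs_decr.
have lcs0 z : lcs 1 z by [].
case: i Lx => [|i] Lx; last first.
  case: j Ly => [|j] Ly; last by rewrite addnS; apply: lcs_comm.
  by rewrite addn0; apply: lcs_decr; apply: lcsS.
rewrite add0n -invgR; apply: subgroupV; first by case: (lcs_normal G j).
by case: j Ly => [|j] Ly //; apply: lcs_decr; apply: lcsS.
Qed.

(** Every filtration with top level G bounds the lower central series, since it
    satisfies the recursion that defines the series as an inclusion. *)
Lemma hom_lcs (G B : groupType) (f : {multiplicative G -> B}) A k x :
  central_filtration A -> lcs k x -> A k (f x).
Proof.
move=> fA; elim: k x => [|[|k] IH] x; try by move=> _; apply: filtT.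
apply: (lcs_ind (preim_subgroup f (filt_subgroup fA _))) => y g Ly.
rewrite /preimage /= homR; apply: (filtR fA (i := k.+1) (j := 1)).
- by rewrite addn1.
- exact: IH.
- exact: filtT.
Qed.

(** * Roots in semidirect products with the integers *)

(** Torsion and infinite divisibility are excluded at once: an element h of
    order p equals h^(1 + p j) for every j. The combined property passes to
    semidirect products with the integers. *)
Definition roots_bounded (G : groupType) :=
  forall z : G, (forall N, exists k h, (N < k)%N /\ h ^+ k = z) -> z = 1.

Lemma roots_bounded_inj (G A : groupType) (f : {multiplicative G -> A}) :
  (forall x, f x = 1 -> x = 1) -> roots_bounded A -> roots_bounded G.
Proof.
move=> fI rA z zR; apply/fI/rA => N; have [k [h [Nk <-]]] := zR N.
by exists k, (f h); rewrite homX.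
Qed.

Section IntIter.
Variables (T : Type) (f g : T -> T).
Hypotheses (fK : cancel f g) (gK : cancel g f).

Definition ziter (a : int) : T -> T :=
  match a with Posz n => iter n f | Negz n => iter n.+1 g end.

Lemma ziterS a x : ziter (a + 1)%R x = f (ziter a x).
Proof.
case: a => n; first by rewrite addrC.
by rewrite NegzE intS opprD addrAC addNr add0r; case: n => [|n] /=; rewrite gK.
Qed.

Lemma ziterD a b x : ziter (a + b)%R x = ziter a (ziter b x).
Proof.
have ziterP a' x' : ziter (a' - 1)%R x' = g (ziter a' x').
  by rewrite -{2}[a'](subrK 1%R) ziterS fK.
elim/int_rect: a => [|n IH|n IH]; first by rewrite add0r.
  by rewrite intS [(1 + _)%R]addrC addrAC !ziterS IH.
by rewrite intS opprD [(-1 + _)%R]addrC addrAC !ziterP IH.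
Qed.

End IntIter.

(** The inverse is part of the data so that integer powers are iterations. *)
Record group_aut (G : groupType) := GroupAut {
  aut : {multiplicative G -> G};
  aut_inv : {multiplicative G -> G};
  autK : cancel aut aut_inv;
  aut_invK : cancel aut_inv aut }.

(** The pair (a, g) stands for x^a g, where the generator x of the integers acts
    on G by t: g^x = t g. *)
Definition zsemi (G : groupType) (t : group_aut G) : Type := (int * G)%type.

Section ZSemidirect.
Variables (G : groupType) (t : group_aut G).
Implicit Types (a b : int) (g h : G).

Definition zact a : G -> G := ziter (aut t) (aut_inv t) a.

Lemma zactD a b g : zact (a + b)%R g = zact a (zact b g).
Proof. exact: ziterD (autK t) (aut_invK t) _ _ _. Qed.

Lemma zactM a : {morph zact a : g h / g * h}.
Proof.
rewrite /zact /ziter.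
case: a => n g h; first by elim: n => //= n ->; rewrite gmulfM.
by elim: n.+1 => //= k ->; rewrite gmulfM.
Qed.

Lemma zact1 a : zact a 1 = 1.
Proof. by apply: (mulgI (zact a 1)); rewrite -zactM !mulg1. Qed.

HB.instance Definition _ := Choice.on (zsemi t).

Definition zsemi_mul (p q : zsemi t) : zsemi t :=
  ((p.1 + q.1)%R, zact q.1 p.2 * q.2).
Definition zsemi_one : zsemi t := (0%R, 1).
Definition zsemi_inv (p : zsemi t) : zsemi t :=
  ((- p.1)%R, zact (- p.1)%R p.2^-1).

Fact zsemi_mulA : associative zsemi_mul.
Proof.
move=> p q u; congr pair => /=; first by rewrite addrA.
by rewrite zactM mulgA [(q.1 + _)%R]addrC zactD.
Qed.

Fact zsemi_mul1g : left_id zsemi_one zsemi_mul.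
Proof.
by case=> a g; rewrite /zsemi_mul /= add0r zact1 mul1g.
Qed.

Fact zsemi_mulg1 : right_id zsemi_one zsemi_mul.
Proof. by case=> a g; rewrite /zsemi_mul /= addr0 mulg1. Qed.

Fact zsemi_mulVg : left_inverse zsemi_one zsemi_inv zsemi_mul.
Proof.
by case=> a g; rewrite /zsemi_mul /= -zactD addNr subrr /= mulVg.
Qed.

Fact zsemi_mulgV : right_inverse zsemi_one zsemi_inv zsemi_mul.
Proof.
by case=> a g; rewrite /zsemi_mul /= -zactM mulgV zact1 subrr.
Qed.

HB.instance Definition _ :=
  isGroup.Build (zsemi t) zsemi_mulA zsemi_mul1g zsemi_mulg1
    zsemi_mulVg zsemi_mulgV.

Lemma zsemiX1 (p : zsemi t) k : (p ^+ k).1 = (p.1 *+ k)%R.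
Proof. by elim: k => // k IH; rewrite expgS mulrS -IH. Qed.

Lemma zsemiX2 g k : ((0%R, g) : zsemi t) ^+ k = (0%R, g ^+ k) :> zsemi t.
Proof. by elim: k => // k IH; rewrite !expgS IH. Qed.

(** If x^a g is a k-th power then k divides a, which bounds k unless a = 0; in
    that case the root lies in G as well. *)
Lemma zsemi_roots_bounded : roots_bounded G -> roots_bounded (zsemi t).
Proof.
move=> rG [a g] gR.
have a0 : a = 0%R.
  have [k [[b h] [ak /(congr1 fst)]]] := gR `|a|%N; rewrite zsemiX1 /= => aE.
  apply/eqP; apply: contraLR ak => a0; rewrite -leqNgt -{}aE in a0 *.
  rewrite -mulr_natr abszM natz absz_nat leq_pmull // absz_gt0.
  by apply: contraNneq a0 => ->; rewrite mul0rn.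
rewrite {}a0 in gR *; congr pair; apply: rG => N.
have [k [[b h] [Nk hE]]] := gR N; exists k, h; split=> //.
have := congr1 fst hE; rewrite zsemiX1 /= => /eqP.
rewrite mulrn_eq0 => /orP[/eqP k0|/eqP b0]; first by rewrite k0 in Nk.
by move: hE; rewrite b0 zsemiX2 => -[].
Qed.

Section ZFiltration.
Variables (A : nat -> set G) (d : nat).
Hypothesis fA : central_filtration A.
Hypothesis At : forall k g, A k g -> A (k + d)%N (g^-1 * aut t g).
Hypothesis Ati : forall k g, A k g -> A (k + d)%N (g^-1 * aut_inv t g).

Lemma zact_filt a k g : A k g -> A k (zact a g).
Proof.
have stab (f : {multiplicative G -> G}) :
    (forall k g, A k g -> A (k + d)%N (g^-1 * f g)) ->
    forall n, A k g -> A k (iter n f g).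
  move=> Af n Ag; elim: n => //= n IH; rewrite -[f _](mulVKg (iter n f g)).
  apply: (filtM fA IH); apply: (filt_le fA (leq_addr d k)); exact: Af.
by case: a => n; apply: stab.
Qed.

(** An automorphism that moves every element by d levels does so after iteration,
    the successive displacements being added up. *)
Lemma zact_filt_shift a k g : A k g -> A (k + d)%N (g^-1 * zact a g).
Proof.
have shift (f : {multiplicative G -> G}) :
    (forall k g, A k g -> A (k + d)%N (g^-1 * f g)) ->
    forall n, A k g -> A (k + d)%N (g^-1 * iter n f g).
  move=> Af n Ag; elim: n => [|n IH] /=.
    by rewrite mulVg; apply: subgroup1 (filt_subgroup fA _).
  have Ai : A k (iter n f g).
    rewrite -[iter _ _ _](mulVKg g); apply: (filtM fA Ag).
    exact: (filt_le fA (leq_addr d k)).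
  by rewrite -[f _](mulVKg (iter n f g)) mulgA; apply: (filtM fA IH); apply: Af.
by case: a => n; apply: shift.
Qed.

(** The filtration of the semidirect product in which x has weight d. *)
Definition zfil k : set (zsemi t) := [set p | A k p.2 /\ ((d < k)%N -> p.1 = 0%R)].

(** The two products p q and q p have the same integer part, so that the
    commutator compares their parts in G. *)
Lemma zsemi_commE (p q : zsemi t) :
  [~ p, q] = (0%R, (zact p.1 q.2 * p.2)^-1 * (zact q.1 p.2 * q.2)) :> zsemi t.
Proof.
apply: (mulgI (q * p)); rewrite -commgC; congr pair => /=.
  by rewrite addr0 addrC.
by rewrite mulVKg.
Qed.

(** The commutator of x^a g and x^b h is [g, h] up to the displacements of g by
    x^b and of h by x^a. The first of these lies d levels below g, which is deep
    enough when the level of x^b h is at most d, and b = 0 otherwise. *)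
Lemma zfil_filtration : (0 < d)%N -> central_filtration zfil.
Proof.
move=> d_gt0; split=> [k|[a g]|k [a g] [Ag a0]|i j [a g] [b h] [Ag a0] [Ah b0]].
- split=> [|[a g] [b h] [Ag a0] [Ah b0]].
    by split=> //; apply: subgroup1 (filt_subgroup fA k).
  split=> /= [|kd]; last first.
    by rewrite /= in a0 b0; rewrite a0 // b0 // subrr.
  by rewrite -zactM; apply: zact_filt; apply: (filtM fA) => //; apply: (filtV fA).
- split=> [|/=]; first exact: (filtT fA).
  by rewrite ltnNge d_gt0.
- split; first exact: (filt_le fA (leqnSn k)).
  by move=> kd; apply: a0; apply: leq_trans kd _.
rewrite /= in Ag a0 Ah b0.
split; rewrite zsemi_commE //=.
have Ag' : A (i + j)%N (g^-1 * zact b g).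
  have [jd|dj] := leqP j d; last first.
    by rewrite b0 //= mulVg; apply: subgroup1 (filt_subgroup fA _).
  apply: (filt_le fA (j := (i + d)%N)); first by rewrite leq_add2l.
  exact: zact_filt_shift.
have Ah' : A (i + j)%N (h^-1 * zact a h).
  have [id|di] := leqP i d; last first.
    by rewrite a0 //= mulVg; apply: subgroup1 (filt_subgroup fA _).
  rewrite addnC.
  apply: (filt_le fA (j := (j + d)%N)); first by rewrite leq_add2l.
  exact: zact_filt_shift.
rewrite -[zact a h](mulVKg h) -[zact b g](mulVKg g).
move: (_ * zact b g) (_ * zact a h) Ag' Ah' => g' h' Ag' Ah'.
have -> : (h * h' * g)^-1 * (g * g' * h) =
    (h'^-1 ^ g) * [~ g, h] * (g' ^ h).
  by rewrite !commgEl !conjgE !invgM !mulgA !(mulgK, mulgVK).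
apply: (filtM fA); last exact: (filtJ fA).
apply: (filtM fA); last exact: (filtR fA (leqnn _) Ag Ah).
by apply: (filtJ fA); apply: (filtV fA).
Qed.

End ZFiltration.
End ZSemidirect.

(** * Weighted free nilpotent groups and elimination *)

(** The smallest central filtration of the free group in which the i-th generator
    has level w i; being inductive, it comes with its universal property. *)
Inductive wfil r (w : 'I_r -> nat) : nat -> free_group r -> Prop :=
| wfil_gen i : wfil w (w i) (free_gen i)
| wfil_one k : wfil w k 1
| wfil_div k u v : wfil w k u -> wfil w k v -> wfil w k (u / v)
| wfil_decr k u : wfil w k.+1 u -> wfil w k u
| wfil_comm i j u v : wfil w i u -> wfil w j v -> wfil w (i + j)%N [~ u, v].

Lemma wfil_filtration r (w : 'I_r -> nat) : (forall i, (0 < w i)%N) ->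
  central_filtration (wfil w : nat -> set (free_group r)).
Proof.
move=> w_gt0.
have sW k : is_subgroup (wfil w k : set (free_group r)).
  by split=> [|x y]; [apply: wfil_one | apply: wfil_div].
split=> // [u|k u|i j u v]; [|exact: wfil_decr|exact: wfil_comm].
apply: (free_group_gen (sW 1%N)) => i.
have := wfil_gen w i; rewrite -(prednK (w_gt0 i)).
by elim: (w i).-1 => // n IH /wfil_decr.
Qed.

Lemma hom_wfil r (w : 'I_r -> nat) (B : groupType)
    (f : {multiplicative free_group r -> B}) A k u :
    central_filtration A -> (forall i, A (w i) (f (free_gen i))) ->
  wfil w k u -> A k (f u).
Proof.
move=> fA fw; elim=> // {k u} [k|k u v _ Au _ Av|k u _ Au|i j u v _ Au _ Av].
- by rewrite hom1; apply: subgroup1 (filt_subgroup fA _).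
- by rewrite homF; apply: (filtM fA Au); apply: (filtV fA Av).
- exact: (filt_le fA (leqnSn k)).
- by rewrite homR; apply: (filtR fA (leqnn _)).
Qed.

(** Modulo the level i + j + d, the perturbations a' and b' commute with all the
    factors they meet in the expansion of the commutator. *)
Lemma filt_comm_shift (G : groupType) (A : nat -> set G) i j d a a' b b' :
    central_filtration A -> A i a -> A (i + d)%N a' -> A j b -> A (j + d)%N b' ->
  A (i + j + d)%N ([~ a, b]^-1 * [~ a * a', b * b']).
Proof.
move=> fA Aa Aa' Ab Ab'; pose nA := filt_normal fA (i + j + d)%N.
pose pi : {multiplicative G -> quot_group nA} := quot_proj nA.
have cpi k l x y : A k x -> A l y -> (i + j + d <= k + l)%N ->
    commute (pi x) (pi y).
  move=> Ax Ay ijd; apply/commgP/eqP; rewrite -homR; apply/quot_proj_eq1.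
  exact: filtR ijd Ax Ay.
have fixE x y : commute (pi x) (pi y) -> pi (x ^ y) = pi x.
  by move=> /commgP/conjg_fixP; rewrite -homJ.
have Aab : A (i + j)%N [~ a, b] by apply: filtR Aa Ab.
have ca'b : commute (pi a') (pi b) by apply: cpi Aa' Ab _; rewrite addnAC.
have cab' : commute (pi a) (pi b') by apply: cpi Aa Ab' _; rewrite addnA.
have ca'b' : commute (pi a') (pi b').
  by apply: cpi Aa' Ab' _; rewrite addnACA leq_add2l leq_addr.
have ceb' : commute (pi [~ a, b]) (pi b').
  by apply: cpi Aab Ab' _; rewrite addnA leq_add2r leq_addr.
have cea' : commute (pi [~ a, b]) (pi a').
  by apply: cpi Aab Aa' _; rewrite addnA leq_add2r leq_addr.
have ab : a ^ b = a * [~ a, b] by rewrite commgEl mulVKg.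
apply/(quot_proj_eq1 nA); change (pi ([~ a, b]^-1 * [~ a * a', b * b']) = 1).
rewrite [[~ a * _, _]]commgEl conjgM 2!conjMg ab.
move: [~ a, b] ceb' cea' => e ceb' cea'.
have -> : pi (e^-1 * ((a * a')^-1 * ((a * e) ^ b' * (a' ^ b) ^ b'))) =
    (pi e)^-1 * ((pi a * pi a')^-1 * (pi ((a * e) ^ b') * pi ((a' ^ b) ^ b'))).
  rewrite (homM pi e^-1) homV (homM pi (a * a')^-1) homV (homM pi a).
  by rewrite (homM pi ((a * e) ^ b')).
have -> : pi ((a * e) ^ b') = pi a * pi e.
  by rewrite conjMg [LHS]gmulfM fixE ?fixE.
have -> : pi ((a' ^ b) ^ b') = pi a' by rewrite homJ fixE // -homJ fixE.
by rewrite -[pi a * _ * _]mulgA cea' invgM !mulgA !mulgVK mulVg.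
Qed.

(** Two homomorphisms that differ by d levels on generators differ by d levels
    everywhere. For g an automorphism composed with f, this says that the
    automorphism acts trivially up to a shift by d. *)
Lemma hom_wfil_shift r (w : 'I_r -> nat) d (B : groupType)
    (f g : {multiplicative free_group r -> B}) A k u :
    central_filtration A -> (forall i, A (w i) (f (free_gen i))) ->
    (forall i, A (w i + d)%N ((f (free_gen i))^-1 * g (free_gen i))) ->
  wfil w k u -> A (k + d)%N ((f u)^-1 * g u).
Proof.
move=> fA fw gw; elim=> // {k u} [k|k u v _ Au _ Av|k u _ Au|i j u v Wu Au Wv Av].
- by rewrite !hom1 mulVg; apply: subgroup1 (filt_subgroup fA _).
- have -> : (f (u / v))^-1 * g (u / v) =
      ((f u)^-1 * g u / ((f v)^-1 * g v)) ^ (f v)^-1.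
    by rewrite !homF !conjgE !invgM !invgK !mulgA mulgK.
  by apply: (filtJ fA); apply: (filtM fA Au); apply: (filtV fA Av).
- by apply: (filt_le fA (j := (k.+1 + d)%N)); rewrite ?leq_add2r.
- rewrite !homR -[g u](mulVKg (f u)) -[g v](mulVKg (f v)).
  by apply: filt_comm_shift => //; apply: (hom_wfil fA).
Qed.

Lemma image_filtration (G B : groupType) (f : {multiplicative G -> B}) A :
  (forall b, exists x, f x = b) -> central_filtration A ->
  central_filtration (fun k => f @` A k).
Proof.
move=> fS fA; split=> [k|b|k|i j _ _ [x Ax <-] [y Ay <-]].
- split=> [|_ _ [x Ax <-] [y Ay <-]].
    by exists 1; rewrite ?hom1 //; apply: subgroup1 (filt_subgroup fA _).
  by exists (x / y); rewrite ?homF //; apply: (filtM fA Ax); apply: (filtV fA).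
- by have [x <-] := fS b; exists x => //; apply: (filtT fA).
- by move=> _ [x Ax <-]; exists x => //; apply: (filt_le fA (leqnSn k)).
- by exists [~ x, y]; rewrite ?homR //; apply: (filtR fA (leqnn _)).
Qed.

Section WQuot.
Variables (c r : nat) (w : 'I_r -> nat).
Hypothesis w_gt0 : forall i, (0 < w i)%N.

(** The free nilpotent group of weighted class c; with all weights equal to 1 it
    is the free nilpotent group of class c. *)
Definition wquot := quot_group (filt_normal (wfil_filtration w_gt0) c.+1).

Definition wproj : {multiplicative free_group r -> wquot} :=
  quot_proj (filt_normal (wfil_filtration w_gt0) c.+1).

Definition wgen i : wquot := wproj (free_gen i).

Definition wqfil k : set wquot := wproj @` wfil w k.

Lemma wproj_surj a : exists u, wproj u = a.
Proof. by exists (repr a); apply: quot_projK. Qed.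

Lemma wqfil_filtration : central_filtration wqfil.
Proof. exact: image_filtration wproj_surj (wfil_filtration w_gt0). Qed.

Lemma wproj_eq1 u : wproj u = 1 <-> wfil w c.+1 u.
Proof. exact: quot_proj_eq1. Qed.

Lemma wqfil_top k a : (c < k)%N -> wqfil k a -> a = 1.
Proof.
move=> ck /(filt_le wqfil_filtration ck) [u Wu <-].
exact/wproj_eq1.
Qed.

Lemma wgen_fil i : wqfil (w i) (wgen i).
Proof. by exists (free_gen i) => //; apply: wfil_gen. Qed.

Lemma wquot_gen (H : set wquot) :
  is_subgroup H -> (forall i, H (wgen i)) -> forall a, H a.
Proof.
move=> sH Hx a; have [u <-] := wproj_surj a.
exact: (free_group_gen (preim_subgroup wproj sH)).
Qed.

(** The universal property that makes [wquot] free among the filtered groups of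
    class c. *)
Lemma wquot_lift (B : groupType) (A : nat -> set B) (v : 'I_r -> B) :
    central_filtration A -> (forall b, A c.+1 b -> b = 1) ->
    (forall i, A (w i) (v i)) ->
  exists f : {multiplicative wquot -> B}, forall i, f (wgen i) = v i.
Proof.
move=> fA A1 Av; pose f0 : {multiplicative free_group r -> B} := free_lift v.
have Af0 i : A (w i) (f0 (free_gen i)) by rewrite /f0 /= free_lift_gen.
have f0K u : wfil w c.+1 u -> f0 u = 1 by move=> /(hom_wfil fA Af0)/A1.
have [f fE] := quot_lift_ex (filt_normal (wfil_filtration w_gt0) c.+1) f0K.
by exists f => i; rewrite /wgen fE /f0 /= free_lift_gen.
Qed.

Lemma wquot_shift d (f : {multiplicative wquot -> wquot}) k a :
    (forall i, wqfil (w i + d)%N ((wgen i)^-1 * f (wgen i))) ->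
  wqfil k a -> wqfil (k + d)%N (a^-1 * f a).
Proof.
move=> fw [u Wu <-].
apply: (hom_wfil_shift (g := f \o wproj) wqfil_filtration wgen_fil) Wu.
exact: fw.
Qed.

End WQuot.

Arguments wqfil c {r w} w_gt0 k _.

Definition zexp (G : groupType) (x : G) (a : int) : G :=
  match a with Posz n => x ^+ n | Negz n => x^-1 ^+ n.+1 end.

Lemma zexpD (G : groupType) (x : G) (a b : int) :
  zexp x (a + b)%R = zexp x a * zexp x b.
Proof.
have zE e z : ziter ( *%g x) ( *%g x^-1) e z = zexp x e * z.
  by case: e => n; rewrite /= iter_mulg // expgS mulgA.
by rewrite -[LHS]mulg1 -[LHS]zE ziterD ?zE ?mulg1 //; [apply: mulKg|apply: mulVKg].
Qed.

(** A homomorphism that turns the automorphism t into conjugation by x turns the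
    action of the integers into conjugation by the powers of x. *)
Lemma zact_conj (G B : groupType) (t : group_aut G)
    (f : {multiplicative G -> B}) x : (forall g, f (aut t g) = f g ^ x) ->
  forall a g, f (zact t a g) = f g ^ zexp x a.
Proof.
move=> ft; have fti g : f (aut_inv t g) = f g ^ x^-1.
  by rewrite -{2}[g](aut_invK t) ft conjgK.
case=> n g; rewrite /zact /ziter /zexp.
  elim: n => [|n IH]; first by rewrite expg0 conjg1.
  by rewrite iterS ft IH -conjgM -expgSr.
elim: n.+1 => [|k IH]; first by rewrite expg0 conjg1.
by rewrite iterS fti IH -conjgM -expgSr.
Qed.

(** Write x for the generator of index i0 and d for its weight. The generator
    (i, k) of the new group stands for the commutator [x_i, x, ..., x] with k
    entries x. The pairs (i0, k) are kept, to avoid a subtype of the indices, and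
    receive the weight c + 1, which makes these generators trivial; the range
    k <= c suffices since commutators with more entries x have weight above c. *)
Section Elimination.
Variables (c r : nat) (w : 'I_r -> nat) (i0 : 'I_r).
Hypothesis w_gt0 : forall i, (0 < w i)%N.
Hypothesis w_i0 : (w i0 <= c)%N.
Let d := w i0.

Definition elim_rank := #|{: 'I_r * 'I_c.+1}|.

Definition elim_weight (j : 'I_elim_rank) : nat :=
  let: (i, k) := enum_val j in if i == i0 then c.+1 else (w i + k * d)%N.

Fact elim_weight_gt0 j : (0 < elim_weight j)%N.
Proof.
rewrite /elim_weight; case: enum_val => i k.
by case: ifP; rewrite // addn_gt0 w_gt0.
Qed.

Let X := wquot c w_gt0.
Let Y := wquot c elim_weight_gt0.
Let A : nat -> set Y := wqfil c elim_weight_gt0.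
Let fA : central_filtration A := wqfil_filtration c elim_weight_gt0.
Let fX : central_filtration (wqfil c w_gt0) := wqfil_filtration c w_gt0.

(* Total in k: the value is trivial outside the range of the generators, so
   that relations between consecutive k need no case distinction. *)
Let yv (i : 'I_r) (k : nat) : Y :=
  if (i != i0) && (k <= c)%N
  then wgen c elim_weight_gt0 (enum_rank (i, inord k)) else 1.

Let wgenE j : wgen c elim_weight_gt0 j = yv (enum_val j).1 (enum_val j).2.
Proof.
rewrite /yv; case jE: (enum_val j) => [i k] /=.
have [ii0|ii0] /= := eqVneq i i0; last first.
  by rewrite -ltnS ltn_ord inord_val -jE enum_valK.
apply: (wqfil_top (leqnn c.+1)).
have := wgen_fil c elim_weight_gt0 j.
by rewrite /elim_weight jE ii0 eqxx.
Qed.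

Let yv_fil i k : A (w i + k * d)%N (yv i k).
Proof.
rewrite /yv; case: ifP => [/andP[ii0 kc]|_]; last first.
  exact: subgroup1 (filt_subgroup fA _).
have := wgen_fil c elim_weight_gt0 (enum_rank (i, inord k)).
by rewrite /elim_weight enum_rankK (negPf ii0) inordK.
Qed.

Let yv_i0 k : yv i0 k = 1. Proof. by rewrite /yv eqxx. Qed.

Let yv_big i k : (c < k)%N -> yv i k = 1.
Proof. by move=> ck; rewrite /yv [(k <= c)%N]leqNgt ck andbF. Qed.

(* The universal property of Y in terms of [yv]. Beyond k = c the family v is
   trivial by its weight, as [yv] is. *)
Let lift_yv (B : groupType) (D : nat -> set B) (v : 'I_r -> nat -> B) :
    central_filtration D -> (forall b, D c.+1 b -> b = 1) ->
    (forall i k, i != i0 -> D (w i + k * d)%N (v i k)) ->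
    (forall k, v i0 k = 1) ->
  exists f : {multiplicative Y -> B}, forall i k, f (yv i k) = v i k.
Proof.
move=> fD D1 Dv v1.
have [f fE] : exists f : {multiplicative Y -> B}, forall j,
    f (wgen c elim_weight_gt0 j) = v (enum_val j).1 (enum_val j).2.
  apply: (wquot_lift _ fD D1) => j; rewrite /elim_weight.
  case: (enum_val j) => i k /=; case: eqVneq => [->|]; last exact: Dv.
  by rewrite v1; apply: subgroup1 (filt_subgroup fD _).
exists f => i k; rewrite /yv; case: ifP => [/andP[_ kc]|/negbT].
  by rewrite fE enum_rankK /= inordK.
rewrite negb_and negbK -ltnNge hom1 => /orP[/eqP->|ck]; first by rewrite v1.
have [->|ii0] := eqVneq i i0; first by rewrite v1.
apply/esym/D1; apply: (filt_le fD) (Dv i k ii0).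
apply: leq_trans ck _; apply: leq_trans (leq_addl _ _).
by rewrite leq_pmulr ?w_gt0.
Qed.

Let eq_Y (B : groupType) (f g : {multiplicative Y -> B}) :
  (forall i k, f (yv i k) = g (yv i k)) -> forall a, f a = g a.
Proof.
move=> fg; apply: (wquot_gen (eq_hom_subgroup f g)) => j /=.
by rewrite wgenE fg.
Qed.

Let A1 b : A c.+1 b -> b = 1. Proof. exact: (wqfil_top (leqnn c.+1)). Qed.
Let X1 b : wqfil c w_gt0 c.+1 b -> b = 1.
Proof. exact: (wqfil_top (leqnn c.+1)). Qed.

Let Asub1 k : A k 1. Proof. exact: subgroup1 (filt_subgroup fA k). Qed.

Let wdS i k : (w i + k * d <= w i + k.+1 * d)%N.
Proof. by rewrite leq_add2l leq_mul2r leqnSn orbT. Qed.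

(** Conjugation by x sends [x_i, x, ..., x] to its product with the commutator
    that has one more entry x, which suggests t. *)
Lemma elim_aut : exists t : group_aut Y,
  [/\ forall i k, aut t (yv i k) = yv i k * yv i k.+1,
      forall k a, A k a -> A (k + d)%N (a^-1 * aut t a)
    & forall k a, A k a -> A (k + d)%N (a^-1 * aut_inv t a)].
Proof.
have [s sE] : exists s : {multiplicative Y -> Y},
    forall i k, s (yv i k) = yv i k * yv i k.+1.
  apply: (lift_yv (v := fun i k => yv i k * yv i k.+1) fA A1) => [i k _|k].
    by apply: (filtM fA) => //; apply: (filt_le fA (wdS i k)).
  by rewrite !yv_i0 mulg1.
(* The inverse sends y_k to b_k with b_k b_(k+1) = y_k, solved downwards
   from b_(c+1) = 1. *)
pose b0 i := fix b0 n k := if n is n'.+1 then yv i k * (b0 n' k.+1)^-1 else 1.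
pose b i k := b0 i (c.+1 - k)%N k.
have bE i k : b i k = yv i k / b i k.+1.
  rewrite /b; have [kc|ck] := leqP k c; first by rewrite subSn.
  have -> : (c.+1 - k.+1 = 0)%N by apply/eqP; rewrite subn_eq0 ltnW.
  have -> : (c.+1 - k = 0)%N by apply/eqP; rewrite subn_eq0.
  by rewrite yv_big //= divgg.
have b_big i k : (c < k)%N -> b i k = 1.
  by rewrite /b -subn_eq0 => /eqP->.
have b_down (P : nat -> Prop) : (forall k, (c < k)%N -> P k) ->
    (forall k, P k.+1 -> P k) -> forall k, P k.
  move=> P1 P2 k; have [n] : exists n, (c < n + k)%N.
    by exists c.+1; rewrite addSn ltnS leq_addr.
  elim: n k => [|n IH] k cnk; first exact: P1.
  by apply/P2/IH; rewrite addnS.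
have Ab i k : A (w i + k * d)%N (b i k).
  elim/b_down: k => [k ck|k IH]; first by rewrite b_big.
  rewrite bE; apply: (filtM fA) => //; apply: (filtV fA).
  exact: (filt_le fA (wdS i k)).
have [s' s'E] : exists s' : {multiplicative Y -> Y},
    forall i k, s' (yv i k) = b i k.
  apply: (lift_yv fA A1) => [i k _|]; first exact: Ab.
  by elim/b_down => [k|k IH]; [apply: b_big|rewrite bE yv_i0 IH mul1g invg1].
have sK : cancel s s'.
  apply: (eq_Y (f := s' \o s) (g := idfun)) => i k /=.
  by rewrite sE homM !s'E (bE i k) mulgVK.
have s'K : cancel s' s.
  apply: (eq_Y (f := s \o s') (g := idfun)) => i k /=.
  rewrite s'E; elim/b_down: k => [k ck|k IH].
    by rewrite b_big // yv_big ?hom1.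
  by rewrite bE homF sE IH mulgK.
exists (GroupAut sK s'K); split=> //= k a Aa; apply: (wquot_shift _ Aa) => j.
  rewrite wgenE sE mulKg /elim_weight; case: enum_val => i l /=.
  case: eqVneq => [->|_]; first by rewrite yv_i0; apply: Asub1.
  by rewrite -addnA -mulSnr; apply: yv_fil.
rewrite wgenE s'E bE mulKg /elim_weight; case: enum_val => i l /=.
apply: (filtV fA).
case: eqVneq => [->|_]; last first.
  by rewrite -addnA -mulSnr; apply: Ab.
suff -> : b i0 l.+1 = 1 by apply: Asub1.
move: l.+1; elim/b_down => [k' |k' IH]; first exact: b_big.
by rewrite bE yv_i0 IH mul1g invg1.
Qed.

(** The weighted free nilpotent group X embeds in the semidirect product of the
    integers with Y, x going to the generator of the integers and the other x_i
    to the generators (i, 0) of Y. Injectivity comes from a retraction q: the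
    commutators [x_i, x, ..., x] define a homomorphism p from Y to X which turns
    t into conjugation by x, and q sends (a, g) to x^a p(g). *)
Lemma elim_roots_bounded :
  roots_bounded (wquot c elim_weight_gt0) -> roots_bounded (wquot c w_gt0).
Proof.
have [t [tE At Ati]] := elim_aut.
have fZ := zfil_filtration fA At Ati (w_gt0 i0).
move=> rY; pose x : X := wgen c w_gt0 i0.
have [f fE] : exists f : {multiplicative X -> zsemi t}, forall i,
    f (wgen c w_gt0 i) = if i == i0 then (1%R, 1) else (0%R, yv i 0).
  apply: (wquot_lift _ fZ) => [[a g] [/= /A1-> ->] //|i].
  case: eqVneq => [->|_]; split=> //=; first by rewrite ltnn.
  by have := yv_fil i 0; rewrite addn0.
pose cm i := fix cm k : X := if k is k'.+1 then [~ cm k', x] else wgen c w_gt0 i.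
have cm_fil i k : wqfil c w_gt0 (w i + k * d)%N (cm i k).
  elim: k => [|k IH] /=; first by rewrite addn0; apply: wgen_fil.
  by apply: (filtR fX _ IH (wgen_fil c w_gt0 i0)); rewrite mulSnr addnA.
have [p pE] : exists p : {multiplicative Y -> X}, forall i k,
    p (yv i k) = if i == i0 then 1 else cm i k.
  apply: (lift_yv (v := fun i k => if i == i0 then 1 else cm i k) fX X1).
    by move=> i k /negPf->.
  by move=> k; rewrite eqxx.
have pt g : p (aut t g) = p g ^ x.
  have sH : is_subgroup [set g | p (aut t g) = p g ^ x].
    split=> [|u v /= pu pv]; first by rewrite /= !hom1 conj1g.
    by rewrite !homF pu pv conjMg conjVg.
  apply: (wquot_gen sH) => j /=; rewrite wgenE tE homM !pE.
  case: ifP => _; first by rewrite mulg1 conj1g.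
  by rewrite /= commgEl mulVKg.
pose q0 (u : zsemi t) : X := zexp x u.1 * p u.2.
have q0M : {morph q0 : u v / u * v}.
  move=> [a g] [b h]; rewrite /q0 /= zexpD homM (zact_conj pt).
  by rewrite conjgE !mulgA mulgK.
pose q : {multiplicative zsemi t -> X} :=
  HB.pack_for {multiplicative zsemi t -> X} q0 (isMultiplicative.Build _ _ q0 q0M).
have fqK : cancel f q.
  apply: (wquot_gen (eq_hom_subgroup (q \o f) idfun)) => i /=.
  rewrite fE; have [->|ii0] := eqVneq i i0.
    by rewrite /q0 /= hom1 mulg1.
  by rewrite /q0 /= pE (negPf ii0) mul1g.
apply: (roots_bounded_inj (f := f) _ (zsemi_roots_bounded (t := t) rY)) => u fu.
by rewrite -[u]fqK fu hom1.
Qed.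

End Elimination.

Arguments elim_weight c {r} w i0 j.

(** Among the new generators, those of the weight d of x are the (i, 0) with i
    different from i0 and x_i of weight d. *)
Lemma elim_weight_card c r (w : 'I_r -> nat) (i0 : 'I_r) :
    (forall i, (0 < w i)%N) -> (w i0 <= c)%N ->
  (#|[set j | elim_weight c w i0 j == w i0]%SET| <
     #|[set i | w i == w i0]%SET|)%N.
Proof.
move=> w_gt0 w_i0.
pose g (j : 'I_(elim_rank c r)) := (enum_val j).1.
have wE (j : 'I_(elim_rank c r)) : elim_weight c w i0 j = w i0 ->
    [/\ g j != i0, w (g j) = w i0 & (enum_val j).2 = 0 :> nat].
  rewrite /elim_weight /g; case jE: (enum_val j) => [i k] /=.
  have [_ cE|ii0 kE] := eqVneq; first by rewrite -cE ltnn in w_i0.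
  have k0 : k = 0 :> nat.
    case: (nat_of_ord k) kE => // k' /eqP.
    rewrite mulSn addnCA -[eqbRHS]addn0 eqn_add2l addn_eq0.
    by rewrite eqn0Ngt w_gt0.
  by rewrite k0 addn0 in kE.
rewrite -(card_in_imset (f := g)).
  apply: proper_card; apply/properP; split.
    apply/fintype.subsetP => i /imsetP[j]; rewrite inE => /eqP/wE[_ wj _] ->.
    by rewrite inE wj.
  exists i0; rewrite ?inE //; apply/negP => /imsetP[j].
  rewrite inE => /eqP/wE[gj _ _] e.
  by rewrite -e eqxx in gj.
move=> j1 j2; rewrite !inE => /eqP/wE[_ _ k1] /eqP/wE[_ _ k2] e.
apply: enum_val_inj; move: e k1 k2; rewrite /g.
case: (enum_val j1) (enum_val j2) => [a1 b1] [a2 b2] /= -> b1E b2E.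
by congr pair; apply: val_inj; rewrite /= b1E b2E.
Qed.

Lemma elim_weight_ge c r (w : 'I_r -> nat) (i0 : 'I_r) j m :
    (forall i, (w i <= c)%N -> (m <= w i)%N) ->
  (elim_weight c w i0 j <= c)%N -> (m <= elim_weight c w i0 j)%N.
Proof.
rewrite /elim_weight => wm; case: (enum_val j) => i k.
case: ifP; rewrite ?ltnn // => _ ic.
by apply: leq_trans (wm i _) (leq_addr _ _); apply: leq_trans ic; apply: leq_addr.
Qed.

(** Elimination removes the generators of the least weight one at a time, then
    those of the next weight, up to weight c. The outer induction is on the
    number m of weights that remain, the inner one on the number of generators of
    the least remaining weight. *)
Theorem wquot_roots_bounded c r (w : 'I_r -> nat) (w_gt0 : forall i, (0 < w i)%N) :
  roots_bounded (wquot c w_gt0).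
Proof.
have [m] : exists m, forall i, (w i <= c)%N -> (c.+1 - m <= w i)%N.
  by exists c.+1 => i _; rewrite subnn.
elim: m r w w_gt0 => [|m IHm] r w w_gt0 wm.
  move=> z _; apply: (wquot_gen (H := [set 1])).
    by split=> // x y -> ->; rewrite divgg.
  move=> i; apply: wqfil_top (wgen_fil c w_gt0 i).
  by rewrite ltnNge; apply/negP => ic; have := wm i ic; rewrite subn0 ltnNge ic.
have [n] := ubnP #|[set i | w i == (c.+1 - m.+1)%N]%SET|.
elim: n r w w_gt0 wm => // n IHn r w w_gt0 wm wn.
have [i0 /eqP wi0|none] := pickP (fun i => w i == (c.+1 - m.+1)%N).
  have ic : (w i0 <= c)%N by rewrite wi0 subSS leq_subr.
  apply: (elim_roots_bounded (w_gt0 := w_gt0) ic); apply: IHn => [j|].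
    by apply: elim_weight_ge => i; apply: wm.
  rewrite -wi0; apply: leq_trans (elim_weight_card w_gt0 ic) _.
  by rewrite -ltnS wi0.
apply: IHm => i ic; rewrite leq_subLR.
have := wm i ic; rewrite leq_eqVlt [_ == w i]eq_sym none /=.
rewrite subSS -(ltn_add2l m); apply: leq_ltn_trans.
by rewrite -leq_subLR.
Qed.

(** * Free groups modulo the lower central series *)

Section FreeLcs.
Variable r : nat.
Notation F := (free_group r).

Definition lproj i : {multiplicative F -> quot_group (lcs_normal F i)} :=
  quot_proj (lcs_normal F i).

Lemma lproj_eq1 i x : lproj i x = 1 <-> lcs i x.
Proof. exact: quot_proj_eq1. Qed.

Lemma lproj_eq i x y : lproj i x = lproj i y <-> lcs i (x / y).
Proof. exact: quot_projP. Qed.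

Lemma lproj_le i j x y :
  (i <= j)%N -> lproj j x = lproj j y -> lproj i x = lproj i y.
Proof.
move=> ij /lproj_eq xy; apply/lproj_eq.
exact: (filt_le (lcs_filtration F) ij).
Qed.

Lemma lproj_surj i a : exists x, lproj i x = a.
Proof. by exists (repr a); apply: quot_projK. Qed.

Lemma lcs_sub i : is_subgroup (@lcs F i).
Proof. by case: (lcs_normal F i). Qed.

Lemma lproj_central i x g :
  lcs i.+1 x -> commute (lproj i.+2 x) (lproj i.+2 g).
Proof.
by move=> Lx; apply/commgP/eqP; rewrite -homR; apply/lproj_eq1; apply: lcsS.
Qed.

(** With all weights equal to 1, the filtration [wfil] and the lower central
    series contain each other, each one being the smallest of its kind. *)
Lemma lcs_quot_roots_bounded c : roots_bounded (quot_group (lcs_normal F c.+1)).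
Proof.
have w_gt0 : forall i : 'I_r, (0 < (fun=> 1%N) i)%N by [].
have fW := wfil_filtration w_gt0.
have [f fE] : exists f : {multiplicative _ -> wquot c w_gt0},
    forall x, f (lproj c.+1 x) = wproj c w_gt0 x.
  apply: quot_lift_ex => x Lx; apply/wproj_eq1.
  exact: (hom_lcs idfun fW Lx).
apply: (roots_bounded_inj (f := f) _ (@wquot_roots_bounded c _ _ w_gt0)) => a.
have [x <-] := lproj_surj a; rewrite fE => /wproj_eq1 Wx.
apply/lproj_eq1.
have L1 (i : 'I_r) : lcs 1 (idfun (free_gen i)) by [].
exact: (hom_wfil (lcs_filtration F) L1 Wx).
Qed.

Lemma lcs_torsion_free c x k :
  (0 < k)%N -> lproj c.+1 x ^+ k = 1 -> lcs c.+1 x.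
Proof.
move=> k_gt0 xk; apply/lproj_eq1/lcs_quot_roots_bounded => N.
exists (k * N).+1, (lproj c.+1 x).
by rewrite ltnS leq_pmull // expgS expgnA xk expg1n mulg1.
Qed.

(** Commutation with y is a homomorphism modulo the next term because its values
    are central there. *)
Lemma lproj_commF i y g h : lcs i.+1 y ->
  lproj i.+3 [~ y, g / h] = lproj i.+3 [~ y, g] / lproj i.+3 [~ y, h].
Proof.
move=> Ly; have Lyg z : lcs i.+2 [~ y, z] by apply: lcsS.
have commM a b :
    lproj i.+3 [~ y, a * b] = lproj i.+3 [~ y, a] * lproj i.+3 [~ y, b].
  have -> : [~ y, a * b] = [~ y, b] * [~ y, a] ^ b.
    by rewrite !commgEl !conjgE !invgM !mulgA !(mulgK, mulgVK).
  rewrite homM homJ [X in _ * X = _](_ : _ = lproj i.+3 [~ y, a]).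
    by apply: lproj_central; apply: Lyg.
  by apply/conjg_fixP/commgP; apply: lproj_central; apply: Lyg.
apply: (mulIg (lproj i.+3 [~ y, h])).
by rewrite mulgVK -commM mulgVK.
Qed.

Lemma lproj_commFl i y z g : lcs i.+1 y -> lcs i.+1 z ->
  lproj i.+3 [~ y / z, g] = lproj i.+3 [~ y, g] / lproj i.+3 [~ z, g].
Proof.
move=> Ly Lz.
have commM a b : lcs i.+1 a ->
    lproj i.+3 [~ a * b, g] = lproj i.+3 [~ a, g] * lproj i.+3 [~ b, g].
  move=> La; have -> : [~ a * b, g] = [~ a, g] ^ b * [~ b, g].
    by rewrite !commgEl !conjgE !invgM !mulgA !(mulgK, mulgVK).
  rewrite homM homJ; congr (_ * _).
  by apply/conjg_fixP/commgP; apply: lproj_central; apply: lcsS.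
apply: (mulIg (lproj i.+3 [~ z, g])).
rewrite mulgVK -commM ?mulgVK //.
by apply: subgroupM => //; [apply: lcs_sub|apply: subgroupV => //; apply: lcs_sub].
Qed.

(** The quotient of y by y' lies one term further down, where its commutators
    with g are trivial. *)
Lemma lproj_commE i y y' g : lproj i.+2 y = lproj i.+2 y' -> 
  lproj i.+3 [~ y, g] = lproj i.+3 [~ y', g].
Proof.
move=> yy'; have Lu : lcs i.+2 (y'^-1 * y).
  by apply/lproj_eq1; rewrite homM homV yy' mulVg.
rewrite -[y](mulVKg y'); set u := _ * y in Lu *.
rewrite !homR homM commgEl conjMg invgM.
have -> : lproj i.+3 u ^ lproj i.+3 g = lproj i.+3 u.
  by apply/conjg_fixP/commgP; apply: lproj_central.
have -> : lproj i.+3 y' ^ lproj i.+3 g =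
    lproj i.+3 y' * [~ lproj i.+3 y', lproj i.+3 g] by rewrite commgEl mulVKg.
have : commute (lproj i.+3 u) [~ lproj i.+3 y', lproj i.+3 g].
  by rewrite -homR; apply: lproj_central.
move: [~ _, _] => e cu; by rewrite -!mulgA mulKg -cu mulKg.
Qed.

Lemma commX_central (G : groupType) (x y : G) m n :
    commute x [~ x, y] -> commute y [~ x, y] ->
  [~ x ^+ m, y ^+ n] = [~ x, y] ^+ (m * n).
Proof.
have X1 (a b : G) k : commute a [~ a, b] -> [~ a ^+ k, b] = [~ a, b] ^+ k.
  move=> ca; rewrite commgEl conjXg.
  have -> : a ^ b = a * [~ a, b] by rewrite commgEl mulVKg.
  by rewrite expgMn // mulKg.
move=> cx cy; have E1 : [~ x ^+ m, y] = [~ x, y] ^+ m by apply: X1.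
have E2 : [~ y, x ^+ m] = [~ x, y] ^- m by rewrite -invgR E1.
rewrite -invgR X1; last by rewrite E2; apply/commuteV/commuteX.
by rewrite E2 expVgn invgK expgnA.
Qed.

(** * The squaring endomorphism *)

Definition sq : {multiplicative F -> F} := free_lift (fun i => free_gen i ^+ 2).

Lemma sq_gen i : sq (free_gen i) = free_gen i ^+ 2.
Proof. exact: free_lift_gen. Qed.

(** On generators the endomorphism squares. If it raises y to the power 2^(i+1) up
    to the next term, it raises [y, x_j] to the power 2^(i+1) * 2 by bilinearity
    of the commutator; these commutators generate the next term modulo the
    following one. *)
Lemma sq_lcs i x : lcs i.+1 x -> lproj i.+2 (sq x) = lproj i.+2 x ^+ (2 ^ i.+1).
Proof.
elim: i x => [|i IH] x.
  move=> _; have sH : is_subgroup [set x | lproj 2 (sq x) = lproj 2 x ^+ 2].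
    (split; rewrite /mkset) => [|a b Ha Hb]; first by rewrite !hom1 expg1n.
    by rewrite !homF Ha Hb expgnFl //; apply: lproj_central.
  by apply: (free_group_gen sH) => j; rewrite /mkset sq_gen homX.
have sH : is_subgroup [set x | lcs i.+2 x /\
    lproj i.+3 (sq x) = lproj i.+3 x ^+ (2 ^ i.+2)].
  (split; rewrite /mkset) => [|a b [La Ha] [Lb Hb]].
    by rewrite !hom1 expg1n; split=> //; apply: subgroup1 (lcs_sub _).
  split; first exact: (lcs_sub i.+2).2.
  by rewrite !homF Ha Hb expgnFl //; apply: lproj_central.
suff H y : lcs i.+2 y -> [set x | lcs i.+2 x /\
    lproj i.+3 (sq x) = lproj i.+3 x ^+ (2 ^ i.+2)] y by move=> /H[].
move: y; apply: (lcs_ind sH) => y g Ly; split; first exact: lcsS.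
have sHg : is_subgroup
    [set g | lproj i.+3 (sq [~ y, g]) = lproj i.+3 [~ y, g] ^+ (2 ^ i.+2)].
  have sqLy : lcs i.+1 (sq y) by exact: (hom_lcs sq (lcs_filtration F) Ly).
  (split; rewrite /mkset) => [|a b Ha Hb]; first by rewrite commg1 !hom1 expg1n.
  rewrite homR homF lproj_commF // -!homR Ha Hb lproj_commF // expgnFl //.
  by apply: lproj_central; apply: lcsS.
apply: (free_group_gen sHg) => j.
rewrite /mkset homR sq_gen.
rewrite (lproj_commE (y' := y ^+ (2 ^ i.+1))); last by rewrite IH // homX.
rewrite homR !homX commX_central -?homR.
- by rewrite [(2 ^ i.+2)%N]expnSr.
- by apply: commute_sym; apply: lproj_central; apply: lcsS.
- by apply: commute_sym; apply: lproj_central; apply: lcsS.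
Qed.

(** Descending along the series, an element of the kernel is a torsion element of
    the next quotient. *)
Lemma sq_lcs_inj i x : lcs i.+1 (sq x) -> lcs i.+1 x.
Proof.
elim: i => [//|i IH] Lsx; have Lx := IH (lcs_decr Lsx).
apply: (@lcs_torsion_free _ _ (2 ^ i.+1)); first by rewrite expn_gt0.
by rewrite -sq_lcs //; apply/lproj_eq1.
Qed.

Lemma sq_iter_lcs i N x : lcs i.+1 x ->
  lproj i.+2 (iter N sq x) = lproj i.+2 x ^+ (2 ^ (i.+1 * N)).
Proof.
move=> Lx; elim: N => [|N IH]; first by rewrite muln0.
have LN : lcs i.+1 (iter N sq x).
  by elim: (N) => //= k Lk; apply: (hom_lcs sq (lcs_filtration F) Lk).
by rewrite iterS sq_lcs // IH -expgnA mulnS expnD mulnC.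
Qed.

(** By bilinearity, the commutators of the generators found for one quotient with
    the free generators generate the following quotient. *)
Lemma lcs_fg i : exists (I : finType) (s : I -> F), (forall z, lcs i.+1 (s z)) /\
  forall x, lcs i.+1 x -> exists2 y, gen (range s) y & lproj i.+2 x = lproj i.+2 y.
Proof.
elim: i => [|i [I [s [Ls sP]]]].
  exists 'I_r, (@free_gen r); split=> // x _; exists x => //.
  by apply: (free_group_gen (gen_subgroup _)) => j; apply: sub_gen; exists j.
pose s' (p : I * 'I_r) := [~ s p.1, free_gen p.2].
exists (I * 'I_r)%type, s'; split=> [z|x Lx]; first exact: lcsS.
pose S := [set x | exists2 y, gen (range s') y & lproj i.+3 x = lproj i.+3 y].
have sS : is_subgroup S.
  split=> [|a b [a' Ga Ea] [b' Gb Eb]].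
    by exists 1 => //; apply: subgroup1 (gen_subgroup _).
  exists (a' / b'); last by rewrite !homF Ea Eb.
  exact: (gen_subgroup (range s')).2.
move: x Lx; apply: (lcs_ind sS) => y g Ly.
have [y' Gy' yy'] := sP y Ly.
suff: S [~ y', g] by rewrite /S /= (lproj_commE g yy').
have sY : is_subgroup [set z | lcs i.+1 z /\ S [~ z, g]].
  split=> [|a b /= [La Sa] [Lb Sb]]; rewrite /=.
    by rewrite comm1g; split; apply: subgroup1 => //; apply: lcs_sub.
  split; first exact: (lcs_sub i.+1).2.
  rewrite /S /= lproj_commFl // -homF; exact: sS.2.
suff: gen (range s) `<=` [set z | lcs i.+1 z /\ S [~ z, g]] by move=> /(_ y' Gy')[].
apply: gen_sub => // _ [z _ <-]; split=> //.
have sG : is_subgroup [set h | S [~ s z, h]].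
  split=> [|a b /= Sa Sb]; first by rewrite /= commg1; apply: subgroup1.
  by rewrite /S /= lproj_commF // -homF; apply: sS.2.
apply: (free_group_gen sG) => j.
by exists [~ s z, free_gen j] => //; apply: sub_gen; exists (z, j).
Qed.

End FreeLcs.

(** * Cosets and states of the squaring endomorphism *)

Lemma hom_prod (G B : groupType) (f : {multiplicative G -> B}) (I : finType)
    (E : I -> G) : f (\prod_i E i) = \prod_i f (E i).
Proof. exact: (big_morph f (homM f) (hom1 f)). Qed.

Lemma finite_bound (X : eqType) (L : seq X) (P : X -> nat -> Prop) :
    (forall e m n, (m <= n)%N -> P e m -> P e n) ->
    (forall e, e \in L -> exists n, P e n) ->
  exists n, forall e, e \in L -> P e n.
Proof.
move=> Pmono; elim: L => [|e L IH] LP; first by exists 0.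
have [|n nP] := IH; first by move=> e' e'L; apply: LP; rewrite inE e'L orbT.
have [m mP] := LP e (mem_head _ _).
exists (m + n)%N => e'; rewrite inE => /predU1P[->|/nP].
  by apply: Pmono mP; apply: leq_addr.
by apply: Pmono; apply: leq_addl.
Qed.

Section Boxes.
Variable r : nat.
Notation F := (free_group r).
Notation lproj i := (lproj r i).
Notation sq := (sq r).

Section Mexp.
Variables (i : nat) (J : finType) (s : J -> F).
Hypothesis Ls : forall j, lcs i.+1 (s j).

(** Exponents are natural numbers: families closed under inversion are used, so
    that a bound on the exponents describes a finite set. *)
Definition mexp (a : J -> nat) : F := \prod_j s j ^+ a j.

Lemma mexp_lcs a : lcs i.+1 (mexp a).
Proof.
have sL := @lcs_sub r i.+1.
apply: (big_ind (@lcs F i.+1)) => [|x y Lx Ly|j _].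
- exact: subgroup1 sL.
- exact: subgroupM sL Lx Ly.
- elim: (a j) => [|n IH]; first exact: subgroup1 sL.
  by rewrite expgS; apply: subgroupM sL (Ls j) IH.
Qed.

Lemma mexpD a b :
  lproj i.+2 (mexp (fun j => a j + b j)%N) = lproj i.+2 (mexp a * mexp b).
Proof.
rewrite homM !hom_prod -prodgM_commute => [|j k _ _].
  by apply: eq_bigr => j _; rewrite expgnDr homM.
by rewrite !homX; apply: commuteX2; apply: lproj_central.
Qed.

Lemma mexpM M a :
  lproj i.+2 (mexp (fun j => M * a j)%N) = lproj i.+2 (mexp a ^+ M).
Proof.
elim: M => [|M IH]; first by rewrite /mexp big1.
(* The exponents M.+1 * a j and a j + M * a j are convertible. *)
by rewrite expgS homM -IH -homM -mexpD.
Qed.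

Lemma mexp_gen : (forall j, exists k, lproj i.+2 (s k) = (lproj i.+2 (s j))^-1) ->
  forall x, gen (range s) x -> exists a, lproj i.+2 x = lproj i.+2 (mexp a).
Proof.
move=> s_sym; pose S := [set x | exists a, lproj i.+2 x = lproj i.+2 (mexp a)].
have S1 : S 1 by exists (fun=> 0%N); rewrite /mexp big1.
have SM x y : S x -> S y -> S (x * y).
  by move=> [a xa] [b yb]; exists (fun j => a j + b j)%N; rewrite mexpD !homM xa yb.
have SX x n : S x -> S (x ^+ n).
  by move=> Sx; elim: n => // n IH; rewrite expgS; apply: SM.
have Sgen j : S (s j).
  exists (fun k => (k == j) : nat); congr (lproj _ _).
  rewrite /mexp (eq_bigr (fun k => if k == j then s k else 1)).
    by rewrite -big_mkcond big_pred1_eq.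
  by move=> k _; case: eqP.
have Sinv x : S x -> S x^-1.
  case=> a xa; suff [b ab] : S (mexp a)^-1 by exists b; rewrite homV xa -homV.
  rewrite /mexp; apply: (big_ind (fun x => S x^-1)) => [|y z Sy Sz|j _].
  - by rewrite invg1.
  - by rewrite invgM; apply: SM.
  - rewrite -expVgn; apply: SX; have [k jk] := s_sym j.
    by have [b kb] := Sgen k; exists b; rewrite homV -jk.
apply: (gen_sub (H := S)) => [|_ [j _ <-]]; last exact: Sgen.
by split=> // x y Sx Sy; apply: SM => //; apply: Sinv.
Qed.

End Mexp.

Lemma lcs_mexp i : exists (J : finType) (s : J -> F), (forall j, lcs i.+1 (s j)) /\
  forall x, lcs i.+1 x -> exists a, lproj i.+2 x = lproj i.+2 (mexp s a).
Proof.
have [I [s [Ls sP]]] := lcs_fg r i.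
pose s2 (p : I * bool) := if p.2 then (s p.1)^-1 else s p.1.
have Ls2 p : lcs i.+1 (s2 p).
  rewrite /s2; case: p => j [] /=; last exact: Ls.
  exact: subgroupV (@lcs_sub r i.+1) (Ls j).
exists (I * bool)%type, s2; split=> // x /sP[y Gy ->].
apply: (mexp_gen Ls2) => [[j b]|].
  by exists (j, ~~ b); case: b; rewrite /s2 /= homV ?invgK.
apply: gen_sub Gy => [|_ [j _ <-]]; first exact: gen_subgroup.
by apply: sub_gen; exists (j, false).
Qed.

(** Z R consists of the products of generators with exponents at most R. The last
    clause is the division of the exponents by 2^(i+1), the power by which the
    squaring endomorphism acts on this quotient: the radius is at least halved,
    which makes the states contract. *)
Lemma lcs_box i : exists Z : nat -> seq F,
  [/\ forall R x, x \in Z R -> lcs i.+1 x,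
      forall x, lcs i.+1 x ->
        exists R, exists2 b, b \in Z R & lproj i.+2 x = lproj i.+2 b,
      forall R R', (R <= R')%N -> {subset Z R <= Z R'},
      forall R R' b b', b \in Z R -> b' \in Z R' ->
        exists2 b2, b2 \in Z (R + R')%N & lproj i.+2 b2 = lproj i.+2 (b * b')
    & forall R x, x \in Z R -> exists z w,
        [/\ z \in Z (2 ^ i.+1)%N, w \in Z R./2
          & lproj i.+2 x = lproj i.+2 (z * w ^+ (2 ^ i.+1))]].
Proof.
have [J [s [Ls sP]]] := lcs_mexp i.
pose Z R := codom (fun a : {ffun J -> 'I_R.+1} => mexp s (fun j => a j)).
have ZP R x : x \in Z R <-> exists2 a, (forall j, a j <= R)%N & x = mexp s a.
  split=> [/codomP[a ->]|[a aR ->]].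
    by exists (fun j => nat_of_ord (a j)) => // j; rewrite -ltnS.
  apply/codomP; exists [ffun j => inord (a j)]; apply: eq_bigr => j _.
  by rewrite ffunE inordK // ltnS.
exists Z; split.
- by move=> R x /ZP[a _ ->]; apply: mexp_lcs.
- move=> x /sP[a ->]; exists (\sum_j a j)%N, (mexp s a) => //.
  by apply/ZP; exists a => // j; rewrite (bigD1 j) //= leq_addr.
- move=> R R' RR' x /ZP[a aR ->]; apply/ZP; exists a => // j.
  exact: leq_trans (aR j) RR'.
- move=> R R' _ _ /ZP[a aR ->] /ZP[b bR ->].
  exists (mexp s (fun j => a j + b j)%N); last exact: mexpD.
  by apply/ZP; eexists; last reflexivity; move=> j; apply: leq_add.
- move=> R _ /ZP[a aR ->]; set M := (2 ^ i.+1)%N.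
  exists (mexp s (fun j => a j %% M)%N), (mexp s (fun j => a j %/ M)%N); split.
  + apply/ZP; eexists; last reflexivity; move=> j.
    by rewrite ltnW // ltn_mod expn_gt0.
  + apply/ZP; eexists; last reflexivity; move=> j /=.
    rewrite -divn2; apply: leq_trans (leq_div2r 2 (aR j)).
    by apply: leq_div2l => //; rewrite /M expnS leq_pmulr // expn_gt0.
  + rewrite homM -mexpM // -homM -mexpD //; congr (lproj _ _).
    by apply: eq_bigr => j _; rewrite addnC mulnC -divn_eq.
Qed.

(** One term further down, the representatives are multiplied by the remainders of
    the division of exponents by 2^(i+1); the quotient part w, raised to this
    power, is the image of w and is central. *)
Lemma sq_cosets i : exists T : seq F, forall g,
  exists x, exists2 t, t \in T & lproj i.+1 g = lproj i.+1 (sq x * t).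
Proof.
elim: i => [|i [T TP]].
  by exists [:: 1] => g; exists 1, 1; rewrite ?mem_head //; apply/lproj_eq.
have [Z [LZ ZP _ _ Zdiv]] := lcs_box i.
exists [seq t * z | t <- T, z <- Z (2 ^ i.+1)%N] => g.
have [x [t Tt gE]] := TP g.
have : lcs i.+1 ((sq x * t)^-1 * g).
  by apply/lproj_eq1; rewrite homM homV gE mulVg.
move=> /ZP[R [b /Zdiv[z [w [Zz Zw bE]]] gb]].
exists (x * w), (t * z); first exact: allpairs_f.
have Lw := LZ _ _ Zw.
rewrite -[g](mulVKg (sq x * t)) homM gb bE !homM homX -sq_lcs //.
have cw y : commute (lproj i.+2 (sq w)) (lproj i.+2 y).
  by apply: lproj_central; apply: (hom_lcs sq (lcs_filtration F) Lw).
by rewrite -!mulgA; congr (_ * _); rewrite -[X in _ = _ * X]homM cw homM mulgA.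
Qed.

(** The states x of s are the solutions of sq x = t s t'^-1. Suppose finitely
    many states are known modulo one term, with lifts S, and let s a be an
    element of S times the next quotient. If a = z w^(2^(i+1)) with z a remainder,
    a state of s a is w times a state of s z. By injectivity the states of the
    finitely many s z stay within a radius C of S; as the radius of w is half
    that of a, the radius 2 C is preserved. *)
Lemma sq_states i (T S0 : seq F) : exists S : seq F,
  (forall x, x \in S0 -> exists2 s, s \in S & lproj i.+1 x = lproj i.+1 s) /\
  (forall s t t' x, s \in S -> t \in T -> t' \in T ->
     lproj i.+1 (sq x) = lproj i.+1 (t * s / t') ->
   exists2 s', s' \in S & lproj i.+1 x = lproj i.+1 s').
Proof.
elim: i => [|i [S [S0S Sclosed]]].
  by exists [:: 1]; split=> [x _|s t t' x _ _ _ _]; exists 1; rewrite ?mem_head //;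
    apply/lproj_eq.
have [Z [LZ ZP Zle Zadd Zdiv]] := lcs_box i.
have approx x s : lproj i.+1 x = lproj i.+1 s ->
    exists R, exists2 b, b \in Z R & lproj i.+2 x = lproj i.+2 (s * b).
  move=> xs; have : lcs i.+1 (s^-1 * x).
    by apply/lproj_eq1; rewrite homM homV xs mulVg.
  move=> /ZP[R [b Zb bE]]; exists R, b => //.
  by rewrite homM -bE -homM mulVKg.
have [C1 C1P] : exists n, forall x, x \in S0 ->
    exists2 s, s \in S & exists2 b, b \in Z n & lproj i.+2 x = lproj i.+2 (s * b).
  apply: finite_bound => [x m n mn [s Ss [b Zb xE]]|x /S0S[s Ss /approx[R bE]]].
    by exists s => //; exists b => //; apply: Zle Zb.
  by exists R, s.
pose U := [seq a / b | a <- [seq a * b | a <- T, b <- [seq a * b | a <- S,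
  b <- Z (2 ^ i.+1)%N]], b <- T].
have [C2 C2P] : exists n, forall u, u \in U -> forall s', s' \in S -> forall x,
    lproj i.+2 (sq x) = lproj i.+2 u -> lproj i.+1 x = lproj i.+1 s' ->
    exists2 b, b \in Z n & lproj i.+2 x = lproj i.+2 (s' * b).
  apply: finite_bound => [u m n mn uP s' Ss' x xu xs'|u _].
    by have [b Zb xE] := uP s' Ss' x xu xs'; exists b => //; apply: Zle Zb.
  apply: finite_bound => [s' m n mn s'P x xu xs'|s' _].
    by have [b Zb xE] := s'P x xu xs'; exists b => //; apply: Zle Zb.
  have [[x [xu xs']]|none] := pselect (exists x, lproj i.+2 (sq x) = lproj i.+2 u
      /\ lproj i.+1 x = lproj i.+1 s'); last first.
    by exists 0%N => x xu xs'; case: none; exists x.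
  have [R [b Zb xE]] := approx x s' xs'; exists R => y yu _; exists b => //.
  rewrite -xE; apply/lproj_eq/sq_lcs_inj/lproj_eq1.
  by rewrite !homF yu xu divgg.
(* C bounds the initial elements too, so that the set contains them. *)
pose C := (C1 + C2)%N.
exists [seq a * b | a <- S, b <- Z (C + C)%N]; split=> [x /C1P[s Ss [b Zb xE]]|].
  exists (s * b) => //; apply: allpairs_f => //; apply: Zle Zb.
  by rewrite /C -addnA leq_addr.
move=> u t t' x /allpairsP[[s a] [Ss Za uE]] Tt Tt' xE.
have {u uE} xE : lproj i.+2 (sq x) = lproj i.+2 (t * (s * a) / t').
  by rewrite xE uE.
have {}Ss : s \in S := Ss; have {}Za : a \in Z (C + C)%N := Za.
have [z [w [Zz Zw aE]]] := Zdiv _ _ Za.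
have La := LZ _ _ Za; have Lw := LZ _ _ Zw.
have [s' Ss' xs'] : exists2 s', s' \in S & lproj i.+1 x = lproj i.+1 s'.
  apply: Sclosed Ss Tt Tt' _; rewrite (lproj_le (leqnSn i.+1) xE) !homM.
  by have /lproj_eq1-> := La; rewrite mulg1.
have cw y : commute (lproj i.+2 (sq w)) (lproj i.+2 y).
  by apply: lproj_central; apply: (hom_lcs sq (lcs_filtration F) Lw).
have [b Zb bE] : exists2 b, b \in Z C2 & lproj i.+2 (x / w) = lproj i.+2 (s' * b).
  apply: (C2P (t * (s * z) / t')) => //.
  - by do 3![apply: allpairs_f => //].
  - rewrite !homF xE !homM aE homM homX -sq_lcs // homV.
    have cwt : lproj i.+2 (sq w) * ((lproj i.+2 t')^-1 / lproj i.+2 (sq w)) =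
        (lproj i.+2 t')^-1 by rewrite -homV mulgA cw mulgK.
    by rewrite -!mulgA cwt.
  - by rewrite homF xs'; have /lproj_eq1-> := Lw; rewrite divg1.
have Zw' : w \in Z C by rewrite addnn doubleK in Zw.
have Zb' : b \in Z C by apply: Zle Zb; apply: leq_addl.
have [b2 Zb2 b2E] := Zadd _ _ _ _ Zb' Zw'.
exists (s' * b2); first exact: allpairs_f.
by rewrite homM b2E -homM mulgA homM -bE -homM mulgVK.
Qed.

End Boxes.

(** * Tree actions of the inverse of an injective endomorphism *)

(** The assumptions on phi make its inverse a simple surjective virtual
    endomorphism; [phi_states] is the finiteness of the sets of states, in a form
    that refers to no transversal. *)
Section SelfSimilar.
Variables (G : groupType) (phi : {multiplicative G -> G}).
Hypothesis phi_inj : injective phi.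
Hypothesis phi_cosets :
  exists T : seq G, forall g, exists x, exists2 t, t \in T & g = phi x * t.
Hypothesis phi_proper : exists g, ~ range phi g.
Hypothesis phi_simple : forall K : set G, is_normal K -> K `<=` range phi ->
  (forall x, K (phi x) -> K x) -> forall x, K x -> x = 1.
Hypothesis phi_states : forall T S0 : seq G, exists2 S : seq G,
  {subset S0 <= S}
  & forall s t t' x, s \in S -> t \in T -> t' \in T ->
      phi x = t * s / t' -> x \in S.
Hypothesis G_fg : exists S0 : seq G, forall g, gen [set` S0] g.

Let H := range phi.
Let sH : is_subgroup H. Proof. exact: range_subgroup. Qed.

Definition inv_endo (a : G) : G := xget 1 [set x | phi x = a].

Lemma inv_endoK x : inv_endo (phi x) = x.
Proof.
by apply: phi_inj; rewrite /inv_endo; case: xgetP => [y -> //|/(_ x)]; case.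
Qed.

Lemma endo_invK a : H a -> phi (inv_endo a) = a.
Proof. by case=> x _ <-; rewrite inv_endoK. Qed.

Lemma right_coset_eq g h : right_coset H g = right_coset H h <-> H (g / h).
Proof.
split=> [gh|Hgh].
  have : right_coset H h g.
    by rewrite -gh; exists 1; rewrite ?mul1g //; apply: subgroup1.
  by case=> k Hk <-; rewrite mulgK.
apply/seteqP; split=> _ [k Hk <-].
  by exists (k * (g / h)); [apply: subgroupM|rewrite -mulgA mulgVK].
exists (k * (g / h)^-1); last by rewrite invgF -mulgA mulgVK.
by apply: subgroupM => //; apply: subgroupV.
Qed.

Lemma coset_index : exists m (idx : G -> 'I_m) (t : 'I_m -> G),
  [/\ has_index H m, forall y, idx (t y) = y
    & forall g h, idx g = idx h <-> H (g / h)].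
Proof.
have [T TP] := phi_cosets.
have /finite_setP[m AI] : finite_set (range (right_coset H)).
  apply: (@sub_finite_set _ _ (right_coset H @` [set` T])).
    move=> _ [g _ <-]; have [x [t Tt ->]] := TP g; exists t => //.
    by apply/right_coset_eq; rewrite invgM mulgA divgg mul1g -homV; exists x^-1.
  exact/finite_image/finite_seq.
have /card_set_bijP[f [fI finj fsurj]] := AI.
have fm g : (f (right_coset H g) < m)%N by apply: fI; exists g.
have tex (y : 'I_m) : exists g, f (right_coset H g) = y.
  by have [_ [g _ <-] gy] := fsurj y (ltn_ord y); exists g.
have [t tE] := choice tex.
exists m, (fun g => Ordinal (fm g)), t; split=> // [y|g h].
  exact/val_inj/tE.
rewrite -right_coset_eq; split=> [[]|gh]; last by apply: val_inj; rewrite /= gh.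
by apply: finj; rewrite inE; [exists g|exists h].
Qed.

Section Action.
Variables (m : nat) (idx : G -> 'I_m) (t : 'I_m -> G).
Hypothesis idxK : forall y, idx (t y) = y.
Hypothesis idxP : forall g h, idx g = idx h <-> H (g / h).

(** The wreath recursion: t_y g = phi(g_y) t_z, where z is the image of y under g
    and g_y the component of g at y. *)
Definition wr_perm g y := idx (t y * g).
Definition wr_comp g y := inv_endo (t y * g / t (wr_perm g y)).

Lemma wr_compE g y : phi (wr_comp g y) = t y * g / t (wr_perm g y).
Proof. by apply/endo_invK/idxP; rewrite idxK. Qed.

Lemma wr_perm1 y : wr_perm 1 y = y.
Proof. by rewrite /wr_perm mulg1 idxK. Qed.

Lemma wr_permM g h y : wr_perm (g * h) y = wr_perm h (wr_perm g y).
Proof.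
apply/idxP; rewrite invgM !mulgA mulgK; apply/idxP.
by rewrite idxK.
Qed.

Lemma wr_compM g h y : wr_comp (g * h) y = wr_comp g y * wr_comp h (wr_perm g y).
Proof.
by apply: phi_inj; rewrite homM !wr_compE wr_permM !mulgA mulgVK.
Qed.

Lemma wr_comp1 y : wr_comp 1 y = 1.
Proof. by apply: phi_inj; rewrite wr_compE wr_perm1 mulg1 divgg hom1. Qed.

Fixpoint tree_act g (u : seq 'I_m) : seq 'I_m :=
  if u is y :: u' then wr_perm g y :: tree_act (wr_comp g y) u' else [::].

Lemma tree_act1 u : tree_act 1 u = u.
Proof. by elim: u => //= y u IH; rewrite wr_perm1 wr_comp1 IH. Qed.

Lemma tree_actM g h u : tree_act (g * h) u = tree_act h (tree_act g u).
Proof.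
by elim: u g h => //= y u IH g h; rewrite wr_permM wr_compM IH.
Qed.

Lemma is_tree_aut_tree_act g : is_tree_aut (tree_act g).
Proof.
apply: is_tree_autI => // [|u y].
  by exists (tree_act g^-1) => u; rewrite -tree_actM ?mulgV ?mulVg tree_act1.
elim: u g => [|x u IH] g /=; first by exists (wr_perm g y).
by have [z ->] := IH (wr_comp g x); exists z.
Qed.

Definition tree_rep0 g : tree_aut m := mk_tree_aut (is_tree_aut_tree_act g).

Fact tree_rep0M : {morph tree_rep0 : g h / g * h}.
Proof. by move=> g h; apply: tree_aut_eq => u; apply: tree_actM. Qed.

Definition tree_rep : {multiplicative G -> tree_aut m} :=
  HB.pack_for {multiplicative G -> tree_aut m} tree_rep0
    (isMultiplicative.Build _ _ tree_rep0 tree_rep0M).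

Lemma tree_repE g u : tree_rep g u = tree_act g u.
Proof. by []. Qed.

Lemma level1_tree_rep g y : level1 (tree_rep g) y = wr_perm g y.
Proof. by rewrite permE. Qed.

Lemma component_tree_rep g y : component (tree_rep g) y = tree_rep (wr_comp g y).
Proof. exact: tree_aut_eq. Qed.

(** An element of the kernel fixes the first level, hence lies in H, and its
    components are in the kernel; the component at the coset H is, up to
    conjugation, its image under the inverse of phi. So the kernel is a normal
    subgroup as in [phi_simple]. *)
Lemma tree_rep_inj : injective tree_rep.
Proof.
pose K := [set g | tree_rep g = 1].
have KP g : K g -> forall y, wr_perm g y = y /\ K (wr_comp g y).
  move=> Kg y; have E u : tree_act g u = u by rewrite -tree_repE Kg.
  split; first by have [] := E [:: y].
  by apply: tree_aut_eq => u; have [] := E (y :: u).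
have nK : is_normal K.
  split=> [|x g]; rewrite /K /mkset; last by move=> Kx; rewrite homJ Kx conj1g.
  by split=> [|x y]; rewrite /mkset ?hom1 // => Kx Ky; rewrite homF Kx Ky divgg.
(* Its representative t y0 lies in H but may differ from 1, whence the
   conjugations by u. *)
pose y0 := idx 1.
have [u _ uE] : H (t y0) by have /idxP := idxK y0; rewrite divg1.
suff K1 x : K x -> x = 1.
  move=> g h gh; apply/divg1_eq/K1; rewrite /K /mkset homF gh.
  exact: divgg.
apply: phi_simple => // [g /KP/(_ y0)[gy _]|z /KP/(_ y0)[zy]].
  exists (wr_comp g y0 ^ u) => //.
  by rewrite homJ uE wr_compE gy conjgE mulgVK mulKg.
have -> : wr_comp (phi z) y0 = z ^ u^-1.
  by apply: phi_inj; rewrite wr_compE zy -uE homJ homV conjgE invgK mulgA.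
by move=> /(nK.2 _ u); rewrite conjgKV.
Qed.

Lemma tree_rep_state_closed : state_closed (range tree_rep).
Proof.
move=> _ [g _ <-]; apply: smallest_sub => [_ y [h _ <-]|_ ->].
  by exists (wr_comp h y) => //; rewrite component_tree_rep.
by exists g.
Qed.

Lemma tree_rep_transitive : level1_transitive (range tree_rep).
Proof.
move=> x y; exists (tree_rep ((t x)^-1 * t y)); first by eexists.
by rewrite level1_tree_rep /wr_perm mulVKg idxK.
Qed.

(** A finite set of elements that contains the generators and their states is the
    state set of an automaton, which acts as these elements do. *)
Lemma tree_rep_automaton :
  exists A : automaton m, range tree_rep = gen (range (@state_aut m A)).
Proof.
have [S0 S0P] := G_fg.
have [S S0S Sclosed] := phi_states (codom t) S0.
have Scomp (q : seq_sub S) y : wr_comp (ssval q) y \in S.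
  apply: (Sclosed (ssval q) (t y) (t (wr_perm (ssval q) y))) (wr_compE _ _).
  - exact: ssvalP.
  - exact: codom_f.
  - exact: codom_f.
pose A : automaton m := {|
  aut_state := seq_sub S;
  aut_out := fun q => level1 (tree_rep (ssval q));
  aut_next := fun q y => SeqSub (Scomp q y) |}.
have stateE (q : aut_state A) : state_aut q = tree_rep (ssval q).
  apply: tree_aut_eq => u; rewrite tree_repE /=.
  elim: u q => //= y u IH q; rewrite IH /=.
  by rewrite -[level1 _]/(level1 (tree_rep (ssval q))) level1_tree_rep.
exists A; apply/seteqP; split=> [_ [g _ <-]|].
  suff : gen [set` S0] `<=` tree_rep @^-1` gen (range (@state_aut m A)) by apply.
  apply: gen_sub => [|s sS0]; first exact/preim_subgroup/gen_subgroup.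
  have qE := stateE (SeqSub (S0S s sS0)).
  by apply: sub_gen; exists (SeqSub (S0S s sS0)).
apply: gen_sub => [|_ [q _ <-]]; first exact: range_subgroup.
by exists (ssval q) => //; rewrite stateE.
Qed.

End Action.

Theorem endo_self_similar :
  recurrent_transitive_self_similar G /\ automata_group G.
Proof.
have [m [idx [t [Hm idxK idxP]]]] := coset_index.
have m_gt1 : (1 < m)%N.
  have [g Hg] := phi_proper; rewrite ltnNge; apply/negP => m1; apply: Hg.
  have /idxP : idx g = idx 1.
    apply/val_inj/eqP; rewrite /=.
    have := ltn_ord (idx g); have := ltn_ord (idx 1).
    case: m m1 {idxK idxP Hm t} idx => [|[|]] // _ idx.
    by rewrite !ltnS !leqn0 => /eqP-> /eqP->.
  by rewrite divg1.
split; last first.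
  have [A AE] := tree_rep_automaton idxK idxP.
  exists m, A, (tree_rep idxK idxP); split=> //; exact: tree_rep_inj.
split.
  exists m, (tree_rep idxK idxP); split=> //.
  - exact: tree_rep_inj.
  - exact: tree_rep_state_closed.
  - exact: tree_rep_transitive.
exists m, H, inv_endo; split=> //.
- split=> // _ _ [x _ <-] [y _ <-].
  by rewrite -homM !inv_endoK.
- move=> K nK KH fK; apply/seteqP; split=> [x Kx|_ ->]; last exact: subgroup1 nK.1.
  apply: (phi_simple nK KH) Kx => y Ky; rewrite -[y]inv_endoK.
  by apply: fK; exists (phi y).
- apply/seteqP; split=> // x _; exists (phi x); last exact: inv_endoK.
  by exists x.
Qed.

End SelfSimilar.

(** * Free nilpotent groups *)

Section FreeNilpotent.
Variables (r c : nat).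
Hypotheses (r_ge1 : (1 <= r)%N) (c_ge1 : (1 <= c)%N).
Notation F := (free_group r).
Notation N := (free_nilpotent r c).
Notation pi := (lproj r c.+1).

(** The parity of the exponent sum; it shows that phi is not surjective, hence that
    the index is at least 2. *)
Lemma parity_hom i : exists e : {multiplicative F -> 'Z_2},
  [/\ forall x, lcs 2 x -> e x = 1, forall x, e (sq r x) = 1
    & e (free_gen i) <> 1].
Proof.
pose e : {multiplicative F -> 'Z_2} := free_lift (fun=> Zp1 : 'Z_2).
have se1 : is_subgroup [set x | e x = 1].
  by split; rewrite /mkset ?hom1 // => x y ex ey; rewrite homF ex ey divgg.
exists e; split.
- apply: (lcs_ind se1) => y g _; rewrite /mkset homR.
  by apply/eqP/commgP; apply: Zp_mulgC.
- apply: (free_group_gen (preim_subgroup (sq r) se1)) => j.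
  rewrite /preimage /mkset sq_gen homX.
  have -> : e (free_gen j) = Zp1 by apply: free_lift_gen.
  exact/val_inj.
- have -> : e (free_gen i) = Zp1 by apply: free_lift_gen.
  by [].
Qed.

(** Going down the series, an element x of K is congruent to the image under the
    n-th iterate of some y of K, which is a power of y of exponent at least 2^n
    in the current quotient; bounded roots force x into the next term. *)
Lemma sq_divisible_trivial (K : set F) :
    (forall x, K x -> exists2 y, K y & pi (sq r y) = pi x) ->
  forall x, K x -> pi x = 1.
Proof.
move=> Ksq; have Kiter n x : K x -> exists2 y, K y & pi (iter n (sq r) y) = pi x.
  elim: n x => [|n IH] x Kx; first by exists x.
  have [y Ky yx] := Ksq x Kx; have [z Kz zy] := IH y Ky; exists z => //.
  rewrite -yx iterS; apply/lproj_eq; rewrite -homF.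
  by apply: (hom_lcs (sq r) (lcs_filtration F)); apply/lproj_eq.
suff H i : (i <= c)%N -> forall x, K x -> lcs i.+1 x.
  by move=> x Kx; apply/lproj_eq1; apply: H.
elim: i => [//|i IH] ic x Kx.
apply/lproj_eq1/lcs_quot_roots_bounded => n.
have [y Ky yx] := Kiter n x Kx; exists (2 ^ (i.+1 * n))%N, (lproj r i.+2 y).
split.
  apply: leq_trans (ltn_expl n (isT : 1 < 2)%N) _.
  by rewrite leq_exp2l // leq_pmull.
rewrite -sq_iter_lcs; last by apply: IH => //; apply: ltnW.
exact: lproj_le yx.
Qed.

Theorem free_nilpotent_self_similar :
  recurrent_transitive_self_similar N /\ automata_group N.
Proof.
have [phi phiE] : exists phi : {multiplicative N -> N},
    forall x, phi (pi x) = pi (sq r x).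
  apply: (@quot_lift_ex _ _ _ _ (pi \o sq r)) => x Lx.
  by apply/lproj_eq1; apply: (hom_lcs (sq r) (lcs_filtration F) Lx).
have phi_inj : injective phi.
  suff phi1 a : phi a = 1 -> a = 1.
    by move=> a b ab; apply/divg1_eq/phi1; rewrite homF ab divgg.
  have [x <-] := lproj_surj a; rewrite phiE => /lproj_eq1/sq_lcs_inj Lx.
  exact/lproj_eq1.
apply: (endo_self_similar phi_inj).
- have [T TP] := sq_cosets r c; exists (map pi T) => a.
  have [g <-] := lproj_surj a; have [x [t Tt gE]] := TP g.
  by exists (pi x), (pi t); rewrite ?map_f // phiE gE homM.
- pose i0 := Ordinal r_ge1; have [e [e2 esq ei0]] := parity_hom i0.
  exists (pi (free_gen i0)) => -[a _]; have [x <-] := lproj_surj a.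
  rewrite phiE => xE; apply: ei0.
  have /lproj_eq : lproj r 2 (free_gen i0) = lproj r 2 (sq r x).
    exact: (lproj_le (j := c.+1)).
  by move=> /e2; rewrite homF esq divg1.
- move=> K nK Kphi KV a Ka; have [x xa] := lproj_surj a; rewrite -xa.
  apply: (@sq_divisible_trivial [set x | K (pi x)]); last by rewrite /mkset xa.
  move=> {xa}{}x Kx.
  have [b _ bx] := Kphi _ Kx; have [y yb] := lproj_surj b.
  exists y; last by rewrite -phiE yb.
  by rewrite /mkset yb; apply: KV; rewrite bx.
- move=> T S0; have [S [S0S Sclosed]] :=
    sq_states c (map (@repr _ N) T) (map (@repr _ N) S0).
  have piK a : pi (repr (a : N)) = a by apply: quot_projK.
  exists (map pi S) => [a aS0|s t t' a].
    have [|s Ss sE] := S0S (repr a); first exact: map_f.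
    by rewrite -[a]piK sE map_f.
  move=> /mapP[u Su ->] Tt Tt' aE; have [x xa] := lproj_surj a.
  rewrite -xa in aE *; have [| | |u' Su' ->] := Sclosed u (repr t) (repr t') x Su.
  + exact: map_f.
  + exact: map_f.
  + by rewrite -phiE aE homF homM !piK.
  + exact: map_f.
- exists (codom (fun i => pi (free_gen i))) => a; have [x <-] := lproj_surj a.
  apply: (free_group_gen (preim_subgroup pi (gen_subgroup _))) => i.
  by apply: sub_gen; apply: codom_f.
Qed.

End FreeNilpotent.

Theorem theoremA (r c : nat) (r_ge1 : (1 <= r)%N) (c_ge1 : (1 <= c)%N) :
  recurrent_transitive_self_similar (free_nilpotent r c) /\
  automata_group (free_nilpotent r c).
Proof. exact: free_nilpotent_self_similar. Qed.
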